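(* Let $\lambda$ be the activity process described in the context, with deterministic initial value $\lambda_0>0$. Then its first moment $m(t):=\mathbb E[\lambda_t]$ satisfies $$m'(t)=\kappa\bar\lambda-(\kappa-\eta\bar g)\,m(t),\qquad m(0)=\lambda_0 .$$ Consequently, under the (mean-subcriticality) condition $\kappa>\eta\bar g$, $$\lim_{t\to\infty}m(t)=\frac{\kappa\bar\lambda}{\kappa-\eta\bar g}.$$ In particular, under this condition, if a stationary distribution of $\lambda$ with finite first moment exists, then its mean must be $$\mathbb E[\lambda_\infty]=\frac{\kappa\bar\lambda}{\kappa-\eta\bar g},$$ where $\lambda_\infty$ denotes a random variable with that stationary distribution.
   Context: $\mathbb R_0=\mathbb R\setminus\{0\}$. For $\vartheta=(p,M,G,\alpha)$ with $p\in(0,1)$, $M,G>0$, $\alpha\in(0,2)$, let $$\bar\nu(dy;\vartheta)=\left[p\frac{M^{2-\alpha}}{\Gamma(2-\alpha)}\frac{e^{-My}}{y^{1+\alpha}}\mathbf 1_{\{y>0\}}+(1-p)\frac{G^{2-\alpha}}{\Gamma(2-\alpha)}\frac{e^{-G|y|}}{|y|^{1+\alpha}}\mathbf 1_{\{y<0\}}\right]dy,$$ a L\'evy measure with $\int y^2\,\bar\nu(dy;\vartheta)=1$. Parameters: $\kappa>0$, $\bar\lambda>0$, $\eta\ge0$, $a>0$; $g(y)=1-e^{-ay^2}$ and $\bar g:=\int_{\mathbb R_0}g(y)\,\bar\nu(dy;\vartheta)<\infty$. On a filtered probability space satisfying the usual conditions, $\mathcal N(dt,dy,d\gamma)$ is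 a Poisson random measure (relative to the filtration) on $[0,\infty)\times\mathbb R_0\times[0,\infty)$ with intensity $dt\,\bar\nu(dy;\vartheta)\,d\gamma$. The activity process $\lambda$ is the pathwise unique nonnegative c\`adl\`ag adapted solution, together with its jump measure $\mu$, of $$\mu(dt,dy)=\int_0^\infty\mathbf 1_{\{\gamma\le\lambda_{t-}\}}\,\mathcal N(dt,dy,d\gamma),\qquad d\lambda_t=\kappa(\bar\lambda-\lambda_t)\,dt+\eta\int_{\mathbb R_0}g(y)\,\mu(dt,dy),$$ started from $\lambda_0$; it satisfies $\mathbb E[\int_0^T\lambda_s\,ds]<\infty$ for all $T<\infty$. The predictable compensator of $\mu$ is $\lambda_{t-}\bar\nu(dy;\vartheta)\,dt$. *)

(* Defs.v *)
From HB Require Import structures.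
From mathcomp Require Import all_boot all_order all_algebra.
From mathcomp Require Import all_classical all_reals all_analysis.
From mathcomp Require Import measurable_realfun.

Set Implicit Arguments.
Unset Strict Implicit.
Unset Printing Implicit Defensive.

Import Order.TTheory GRing.Theory Num.Theory.
Import numFieldNormedType.Exports.

Local Open Scope classical_set_scope.
Local Open Scope ring_scope.

Definition Gamma_fun {R : realType} (s : R) : R :=
  \int[lebesgue_measure]_(x in `]0, +oo[) (x `^ (s - 1) * expR (- x)).

Record tempered_param (R : realType) := TemperedParam {
  tp_p : R;
  tp_M : R;
  tp_G : R;
  tp_alpha : R;
  tp_p_gt0 : 0 < tp_p;
  tp_p_lt1 : tp_p < 1;
  tp_M_gt0 : 0 < tp_M;
  tp_G_gt0 : 0 < tp_G;
  tp_alpha_gt0 : 0 < tp_alpha;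
  tp_alpha_lt2 : tp_alpha < 2 }.

Section levy_measure.
Context {R : realType}.
Implicit Types (th : tempered_param R) (y : R).

Definition tempered_tail (alpha c y : R) : R :=
  c `^ (2 - alpha) / Gamma_fun (2 - alpha) *
  (expR (- (c * y)) / y `^ (1 + alpha)).

Definition levy_density th y : R :=
  if 0 < y then tp_p th * tempered_tail (tp_alpha th) (tp_M th) y
  else if y < 0 then
    (1 - tp_p th) * tempered_tail (tp_alpha th) (tp_G th) `|y|
  else 0.

Definition levy_measure th (A : set (measurableTypeR R)) : \bar R :=
  (\int[lebesgue_measure]_(y in A) (levy_density th y)%:E)%E.

Lemma Gamma_fun_ge0 (s : R) : 0 <= Gamma_fun s.
Proof.
by apply: Rintegral_ge0 => x _; rewrite mulr_ge0 ?powR_ge0 ?expR_ge0.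
Qed.

Lemma tempered_tail_ge0 (alpha c y : R) : 0 <= tempered_tail alpha c y.
Proof.
by rewrite !mulr_ge0 ?invr_ge0 ?powR_ge0 ?expR_ge0 ?Gamma_fun_ge0.
Qed.

Lemma levy_density_ge0 th y : 0 <= levy_density th y.
Proof.
rewrite /levy_density; case: ifP => _; [|case: ifP => // _].
- by rewrite mulr_ge0 ?tempered_tail_ge0 ?(ltW (tp_p_gt0 th)).
- by rewrite mulr_ge0 ?tempered_tail_ge0 ?subr_ge0 ?(ltW (tp_p_lt1 th)).
Qed.

Lemma measurable_tempered_tail (alpha c : R) :
  measurable_fun [set: R] (tempered_tail alpha c).
Proof.
apply: (@measurable_funM _ _ _ setT (cst _)) => //.
refine (@measurable_funM _ _ _ setT _ _ _ _).
  apply: (measurableT_comp (@measurable_expR R)).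
  apply: (measurableT_comp (@oppr_measurable R setT)).
  exact: (@measurable_funM _ _ _ setT (cst _)).
rewrite (_ : (fun y => _) = (fun y : R => y `^ (- (1 + alpha)))); last first.
  by apply/funext => y; rewrite powRN.
exact: measurable_powR.
Qed.

Lemma measurable_levy_density th :
  measurable_fun [set: R] (levy_density th).
Proof.
apply: measurable_fun_ifT => /=.
- exact: measurable_fun_ltr.
- apply: (@measurable_funM _ _ _ setT (cst _)) => //.
  exact: measurable_tempered_tail.
- apply: measurable_fun_ifT => //=.
  + exact: measurable_fun_ltr.
  + apply: (@measurable_funM _ _ _ setT (cst _)) => //.
    apply: measurableT_comp => //.
    exact: measurable_tempered_tail.
Qed.

Let levy_measure0 th : levy_measure th set0 = 0%E.
Proof. by rewrite /levy_measure integral_set0. Qed.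

Let levy_measure_ge0 th A : (0 <= levy_measure th A)%E.
Proof.
by apply: integral_ge0 => y _; rewrite lee_fin levy_density_ge0.
Qed.

Let levy_measure_sigma_additive th : semi_sigma_additive (levy_measure th).
Proof.
move=> F mF tF mUF; rewrite /levy_measure ge0_integral_bigcup//; last 2 first.
- by apply/measurable_EFinP/measurable_funTS; exact: measurable_levy_density.
- by move=> y _; rewrite lee_fin levy_density_ge0.
apply: is_cvg_nneseries => n _ _.
by apply: integral_ge0 => y _; rewrite lee_fin levy_density_ge0.
Qed.

HB.instance Definition _ th := isMeasure.Build _ _ _ (levy_measure th)
  (levy_measure0 th) (levy_measure_ge0 th) (@levy_measure_sigma_additive th).

Let levy_measure_sigma_finite th : sigma_finite setT (levy_measure th).
Proof.
pose F n := `[(- n%:R)%R, n%:R]%classic `&`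
  [set y | levy_density th y <= n%:R].
exists F.
  apply/esym; rewrite -subTset => y _.
  have [n nle] : exists n, Num.max `|y| (levy_density th y) <= n%:R.
    exists (Num.truncn (Num.max `|y| (levy_density th y))).+1.
    exact/ltW/truncnS_gt.
  exists n => //; rewrite /F /= in_itv/= -ler_norml.
  by move: nle; rewrite ge_max => /andP[].
have mF n : measurable (F n).
  apply: measurableI => //.
  rewrite (_ : [set _ | _] = levy_density th @^-1` `]-oo, n%:R]); last first.
    by apply/seteqP; split => y /=; rewrite in_itv.
  rewrite -[X in measurable X]setTI; exact: measurable_levy_density.
move=> n; split; first exact: mF.
rewrite /levy_measure.
apply: (@le_lt_trans _ _ (\int[lebesgue_measure]_(y in F n) (n%:R : R)%:E)%E).
  apply: ge0_le_integral => //.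
  - exact: mF.
  - by move=> y _; rewrite lee_fin levy_density_ge0.
  - by apply/measurable_EFinP/measurable_funTS; exact: measurable_levy_density.
  - by move=> y [_ /=]; rewrite lee_fin.
rewrite integral_cst/=; last exact: mF.
rewrite lte_mul_pinfty// ?lee_fin//.
apply: (@le_lt_trans _ _ (lebesgue_measure `[(- n%:R : R)%R, n%:R]%classic)).
  by apply: le_measure; rewrite ?inE//; [exact: mF|exact: subIsetl].
by rewrite lebesgue_measure_itv/=; case: ifP => _; rewrite ltry.
Qed.

HB.instance Definition _ th := Measure_isSigmaFinite.Build _ _ _
  (levy_measure th) (levy_measure_sigma_finite th).

End levy_measure.

(* the sigma-finite structure of [m1 \x m2] is not inferred by the library *)
Lemma product_measure1_sigma_finite d1 d2 (T1 : measurableType d1)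
    (T2 : measurableType d2) (R : realType)
    (m1 : {sigma_finite_measure set T1 -> \bar R})
    (m2 : {sigma_finite_measure set T2 -> \bar R}) :
  sigma_finite setT (m1 \x m2)%E.
Proof.
have /sigma_finiteP[F [TF ndF Foo]] := sigma_finiteT m1.
have /sigma_finiteP[G [TG ndG Goo]] := sigma_finiteT m2.
exists (fun n => F n `*` G n).
  rewrite -setXTT TF TG predeqE => -[x y]; split.
    move=> [/= [n _ Fnx] [k _ Gky]]; exists (maxn n k) => //; split.
    - by move: x Fnx; exact/subsetPset/ndF/leq_maxl.
    - by move: y Gky; exact/subsetPset/ndG/leq_maxr.
  by move=> [n _ []/= ? ?]; split; exists n.
move=> k; have [? ?] := Foo k; have [? ?] := Goo k.
split; first exact: measurableX.
by rewrite product_measure1E// lte_mul_pinfty// ge0_fin_numE.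
Qed.

Section intensity.
Context {R : realType}.
Local Notation TR := (measurableTypeR R).

Definition mark_measure (th : tempered_param R) : set (TR * TR) -> \bar R :=
  (levy_measure th \x lebesgue_measure)%E.

HB.instance Definition _ th := Measure.on (mark_measure th).

HB.instance Definition _ th := Measure_isSigmaFinite.Build _ _ _
  (mark_measure th) (product_measure1_sigma_finite _ _).

(* dt nubar(dy) dgamma, with points written (t, (y, gamma)) *)
Definition thinning_intensity (th : tempered_param R) :
    set (TR * (TR * TR)) -> \bar R :=
  (lebesgue_measure \x mark_measure th)%E.

HB.instance Definition _ th := Measure.on (thinning_intensity th).

HB.instance Definition _ th := Measure_isSigmaFinite.Build _ _ _
  (thinning_intensity th) (product_measure1_sigma_finite _ _).

End intensity.

Definition activity_kernel {R : realType} (a y : R) : R :=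
  1 - expR (- (a * y ^+ 2)).

Definition gbar {R : realType} (th : tempered_param R) (a : R) : R :=
  \int[levy_measure th]_(y in [set y : R | y != 0]) activity_kernel a y.

Section stochastic_basis.
Context {d} {Omega : measurableType d} {R : realType}.
Variables (P : probability Omega R) (F : R -> set (set Omega)).

Record usual_conditions : Prop := UsualConditions {
  filtration_sigma_algebra :
    forall t : R, 0 <= t -> sigma_algebra [set: Omega] (F t);
  filtration_measurable : forall t : R, 0 <= t -> F t `<=` measurable;
  filtration_mono : forall s t : R, 0 <= s -> s <= t -> F s `<=` F t;
  filtration_right_continuous :
    forall t : R, 0 <= t -> \bigcap_(u in [set u | t < u]) F u `<=` F t;
  filtration_complete : P.-negligible `<=` F 0 }.

Definition adapted (X : R -> Omega -> R) :=
  forall t : R, 0 <= t -> forall A, measurable A -> F t (X t @^-1` A).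

(* A random measure is a kernel from Omega; the first coordinate of a point is
   the time, and only the part of the measure carried by D is relevant. *)
Record poisson_random_measure d' (E : measurableType d') (D : set (R * E))
    (m : set (R * E) -> \bar R) (N : R.-ker Omega ~> (R * E)%type) : Prop :=
  PoissonRandomMeasure {
  prm_integer : forall w B, measurable B -> B `<=` D ->
    N w B = +oo%E \/ exists k : nat, N w B = k%:R%:E;
  (* the second argument of [poisson_prob] is a dummy; [poisson_pmf] is not
     used because it is constantly 1 at rate 0 *)
  prm_poisson : forall B, measurable B -> B `<=` D -> (m B < +oo)%E ->
    forall k : nat,
      P [set w | N w B = k%:R%:E] = poisson_prob (fine (m B)) k [set k];
  prm_infinite : forall B, measurable B -> B `<=` D -> m B = +oo%E ->
    P [set w | N w B = +oo%E] = 1%E;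
  prm_disjoint_indep : forall n (B : 'I_n -> set (R * E))
      (C : 'I_n -> set (\bar R)),
    (forall i, measurable (B i) /\ B i `<=` D) -> trivIset setT B ->
    (forall i, measurable (C i)) ->
    P (\bigcap_i [set w | C i (N w (B i))]) =
    (\prod_(i < n) P [set w | C i (N w (B i))])%E;
  prm_adapted : forall (t : R) B, 0 <= t -> measurable B -> B `<=` D ->
    B `<=` [set x | x.1 <= t] ->
    forall C, measurable C -> F t [set w | C (N w B)];
  prm_future_indep : forall t : R, 0 <= t -> forall A Z, F t A ->
    <<s [set Y | exists B C, [/\ measurable B, B `<=` D,
                    B `<=` [set x | t < x.1], measurable C &
                    Y = [set w | C (N w B)]]] >> Z ->
    P (A `&` Z) = (P A * P Z)%E }.

End stochastic_basis.

Section activity_process.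
Context {R : realType}.

Definition cadlag (x : R -> R) :=
  (forall t : R, 0 <= t -> x s @[s --> t^'+] --> x t) /\
  (forall t : R, 0 < t -> cvg (x s @[s --> t^'-])).

(* convention: x(0-) = x(0) *)
Definition left_limit (x : R -> R) (t : R) : R :=
  if t == 0 then x 0 else lim (x s @[s --> t^'-]).

(* [0, +oo[ * R_0 * [0, +oo[ *)
Definition mark_domain : set (R * (R * R)) :=
  [set x | [/\ 0 <= x.1, x.2.1 != 0 & 0 <= x.2.2]].

Record activity_process (th : tempered_param R) (kappa lbar eta a : R)
    d (Omega : measurableType d) (P : probability Omega R)
    (F : R -> set (set Omega)) (N : R.-ker Omega ~> (R * (R * R))%type)
    (lambda : R -> Omega -> R) (mu : R.-ker Omega ~> (R * R)%type) : Prop :=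
  ActivityProcess {
  ap_usual : usual_conditions P F;
  ap_prm : poisson_random_measure P F mark_domain (thinning_intensity th) N;
  ap_ge0 : forall (t : R) w, 0 <= t -> 0 <= lambda t w;
  ap_cadlag : forall w, cadlag (lambda ^~ w);
  ap_adapted : adapted F lambda;
  ap_jump_measure : {ae P, forall w, forall A : set (R * R), measurable A ->
    mu w A = (\int[N w]_(x in mark_domain `&` [set x | A (x.1, x.2.1)])
      (\1_[set g : R | g <= left_limit (lambda ^~ w) x.1] x.2.2)%:E)%E};
  ap_sde : {ae P, forall w, forall t : R, 0 <= t ->
    ((lambda t w)%:E = (lambda 0 w)%:E
      + \int[lebesgue_measure]_(s in `[0%R, t]) (kappa * (lbar - lambda s w))%:E
      + eta%:E * \int[mu w]_(z in [set z : R * R | [/\ 0 < z.1, z.1 <= t & z.2 != 0]%R])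
                   (activity_kernel a z.2)%:E)%E} }.

(* pi is the time-invariant one-dimensional law of some solution, on some
   filtered probability space carrying the driving random measure *)
Definition stationary_distribution (th : tempered_param R)
    (kappa lbar eta a : R) (pi : probability R R) : Prop :=
  exists (d : measure_display) (Omega : measurableType d)
    (P : probability Omega R) (F : R -> set (set Omega))
    (N : R.-ker Omega ~> (R * (R * R))%type)
    (lambda : R -> Omega -> R) (mu : R.-ker Omega ~> (R * R)%type),
    activity_process th kappa lbar eta a P F N lambda mu /\
    forall t : R, 0 <= t -> forall A, measurable A ->
      P (lambda t @^-1` A) = pi A.

Definition first_moment d (Omega : measurableType d) (P : probability Omega R)
    (lambda : R -> Omega -> R) (t : R) : R := fine ('E_P[lambda t])%E.

End activity_process.

(* Main.v *)
From HB Require Import structures.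
Require Import Defs.
From mathcomp Require Import all_boot all_order all_algebra.
From mathcomp Require Import all_classical all_reals all_analysis.
From mathcomp Require Import measurable_realfun.
From mathcomp Require Import ring lra.

(** The idea is to take expectations in the stochastic equation of the activity
process. With [m t = E (lambda t)] this gives the affine integral
equation
  [m T = m 0 + int_0^T (kappa * lbar - (kappa - eta * gbar) * m s) ds],
whose only solution relaxes exponentially to [kappa * lbar / (kappa - eta *
gbar)] when [eta * gbar < kappa].

The drift is handled by Tonelli's theorem. The substance is the jump term: one
needs the expected sum of the activity kernel over the jumps of [mu] up to
time [T] to be [gbar * E (int_0^T lambda_(s-) ds)]. The jumps are the atoms
[(s, y, gamma)] of the driving Poisson random measure [N] that lie below the
graph of the left limit of [lambda], so this is the compensation formula
[E (sum of H over the atoms of N) = int H d(P x nu)] for a nonnegative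
predictable integrand [H], where [nu] is the intensity of [N]
([compensation_formula]). On a rectangle
[A x ]s, t] x B] with [A] known at time [s], the formula holds because [A] is
independent of the mass of [N] on the future set [ ]s, t] x B], a Poisson
variable of mean [nu (]s, t] x B)] ([prm_mean]); both sides being measures
on the predictable sigma-algebra, and the rectangles being stable under
intersection, it holds for all [H]. That [lambda_(s-)] is predictable follows
from its being a limit of adapted step processes
([measurable_predictable_left_limit]), and [lambda_(s-)] may be replaced by
[lambda_s] in time integrals because a path has countably many jumps
([countable_left_jumps]).

Two finiteness facts turn the resulting identity in the extended nonnegative
reals ([mean_balance]) into the integral equation for [m]: [gbar] is a
convergent integral ([levy_activity_kernel_integral]), since
[1 - exp (- a y^2)] is at most [min (a y^2) 1] and the singularity of the Levy
density at 0 has order [1 + alpha < 3]; and the expected occupation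
[E (int_0^T lambda_s ds)] is finite.

For a stationary law [pi] the same identity applies at [T = 1] to a solution
with marginals [pi]. Its mean [M] is constant in time, so the expected
occupation is [M], finite as soon as [pi] has a first moment, and the balance
reads [M + kappa * M = M + kappa * lbar + eta * gbar * M]. *)

Set Implicit Arguments.
Unset Strict Implicit.
Unset Printing Implicit Defensive.

Import Order.TTheory GRing.Theory Num.Theory.
Import numFieldNormedType.Exports.

Local Open Scope classical_set_scope.
Local Open Scope ring_scope.

(** * Mean of a Poisson random measure *)

Lemma poisson_prob_sum1 (R : realType) (r : R) (j : nat) :
  (\sum_(k <oo) poisson_prob r j [set k] = 1)%E.
Proof.
rewrite -(@probability_setT _ _ _ (poisson_prob r j)).
have -> : [set: nat] = \bigcup_k [set k].
  by apply/esym; rewrite -subTset => k _; exists k.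
rewrite measure_bigcup//.
- by apply: eq_eseriesl => k; rewrite in_setT.
- by apply/trivIsetP => a b _ _ /eqP ab; rewrite -subset0 => x [/= -> /ab].
Qed.

(** The factor [k] cancels against the factorial and shifts the index, leaving
[r] times the total mass. At rate 0 the law is a Dirac mass and is treated
apart. *)
Lemma poisson_mean (R : realType) (r : R) : 0 <= r ->
  (\sum_(k <oo) k%:R%:E * poisson_prob r k [set k] = r%:E)%E.
Proof.
rewrite le_eqVlt => /predU1P[<-|r0].
  apply: eseries0 => k _ _; rewrite /poisson_prob ltxx diracE.
  have [->|k0] := eqVneq k 0%N; first by rewrite mul0e.
  by rewrite memNset ?mule0//= => /eqP; rewrite eq_sym (negbTE k0).
have pE k j : poisson_prob r j [set k] = (poisson_pmf r k)%:E.
  by rewrite /poisson_prob r0 esum_set1// lee_fin poisson_pmf_ge0.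
have p0 k j : (0 <= poisson_prob r j [set k])%E by rewrite pE lee_fin poisson_pmf_ge0.
rewrite nneseries_recl//; last by move=> k _; rewrite mule_ge0// lee_fin.
rewrite mul0e add0e -(@nneseries_addn _ (fun k => k%:R%:E * _)%E 1%N); last first.
  by move=> k; rewrite mule_ge0.
rewrite (eq_eseriesr (g := fun k => r%:E * poisson_prob r 0%N [set k])%E); last first.
  move=> k _; rewrite !pE -!EFinM /poisson_pmf r0 addn1; congr EFin.
  rewrite factS natrM invfM exprS !mulrA (mulrC _ r) -!mulrA; congr (_ * _).
  by rewrite !mulrA (mulrC k.+1%:R) -!mulrA (mulrA k.+1%:R) mulfV ?pnatr_eq0// mul1r.
by rewrite nneseriesZl// poisson_prob_sum1 mule1.
Qed.

(** A counting variable is integrated through its level sets. This is the form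
in which the axioms of a Poisson random measure give information: they speak
only of the events [N B = k]. *)
Section count_integral.
Context d (T : measurableType d) (R : realType).
Variables (P : {measure set T -> \bar R}) (X : T -> \bar R).
Hypothesis mX : measurable_fun setT X.
Hypothesis Xnat : forall w, X w = +oo%E \/ exists k : nat, X w = k%:R%:E.

Lemma measurable_level (c : \bar R) : measurable [set w | X w = c].
Proof.
by have := mX measurableT (emeasurable_set1 c); rewrite setTI.
Qed.

Lemma integral_count (A : set T) : measurable A ->
  P [set w | X w = +oo%E] = 0%E ->
  (\int[P]_(w in A) X w =
   \sum_(k <oo) k%:R%:E * P (A `&` [set w | X w = k%:R%:E]))%E.
Proof.
move=> mA Poo.
pose f k w : \bar R := (k%:R * \1_[set w | X w = k%:R%:E] w)%:E.
have mf k : measurable_fun setT (f k).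
  apply/measurable_EFinP/measurable_funM => //.
  exact/measurable_indic/measurable_level.
have f0 k w : (0 <= f k w)%E by rewrite lee_fin mulr_ge0.
have X0 w : (0 <= X w)%E by have [->|[k ->]] := Xnat w; rewrite ?lee_fin.
rewrite (@ge0_ae_eq_integral _ _ _ _ _ X (fun w => \sum_(k <oo) f k w)%E)//.
- rewrite integral_nneseries//; last by move=> k; exact: measurable_funTS.
  apply: eq_eseriesr => k _.
  rewrite /f; under eq_integral do rewrite EFinM.
  rewrite ge0_integralZl//; last first.
    exact/measurable_EFinP/measurable_funTS/measurable_indic/measurable_level.
  by rewrite integral_indic//; [rewrite setIC|exact: measurable_level].
- exact: measurable_funTS.
- by apply: measurable_funTS; apply: ge0_emeasurable_sum.
- by move=> w _; exact: nneseries_ge0.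
- exists [set w | X w = +oo%E]; split => //; first exact: measurable_level.
  move=> w /= /not_implyP[Aw]; apply: contra_notP => Xw.
  have [//|[k Xk]] := Xnat w.
  rewrite (@nneseriesD1 _ _ k)// eseries0 ?adde0.
    by rewrite /f indicE mem_set// mulr1.
  move=> i _ /andP[_ ik]; rewrite /f indicE memNset ?mulr0//= Xk => -[] /eqP.
  by rewrite eqr_nat eq_sym (negbTE ik).
Qed.

End count_integral.

Section poisson_random_measure_mean.
Context d (Omega : measurableType d) (R : realType) d' (E : measurableType d').
Variables (P : probability Omega R) (F : R -> set (set Omega)).
Variables (D : set (R * E)) (m : {measure set (R * E) -> \bar R}).
Variable N : R.-ker Omega ~> (R * E)%type.
Hypothesis usualF : usual_conditions P F.
Hypothesis prmN : poisson_random_measure P F D m N.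

Lemma measurable_prm_level (B : set (R * E)) (c : \bar R) : measurable B ->
  measurable [set w | N w B = c].
Proof.
move=> mB.
have := measurable_kernel N B mB measurableT _ (emeasurable_set1 c).
by rewrite setTI.
Qed.

(** The Poisson weights of the finite values of [N B] already sum to 1. *)
Lemma prm_finite (B : set (R * E)) : measurable B -> B `<=` D ->
  (m B < +oo)%E -> P [set w | N w B = +oo%E] = 0%E.
Proof.
move=> mB BD mBoo.
pose L k := [set w | N w B = k%:R%:E].
have mL k : measurable (L k) by exact: measurable_prm_level.
have PL : P (\bigcup_k L k) = 1%E.
  rewrite measure_bigcup//; last first.
    apply/trivIsetP => a b _ _ ab; rewrite -subset0 => w []; rewrite /L/= => -> [] /eqP.
    by rewrite eqr_nat (negbTE ab).
  rewrite -(poisson_prob_sum1 (fine (m B)) 0).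
  rewrite [LHS](eq_eseriesl (Q := xpredT)); last by move=> k; rewrite in_setT.
  by apply: eq_eseriesr => k _; exact: (prm_poisson prmN mB BD mBoo).
have -> : [set w | N w B = +oo%E] = ~` (\bigcup_k L k).
  apply/seteqP; split => [w /= Nw [k _]|w /= kNw]; first by rewrite /L/= Nw.
  have [//|[k Nw]] := prm_integer prmN w mB BD.
  by exfalso; apply: kNw; exists k.
by rewrite probability_setC ?PL ?subee//; exact: bigcup_measurable.
Qed.

(** Independence of the past: when [B] lies strictly after time [t], the event
[A] of [F t] is independent of every level set of [N B], so the expectation
factors. This is the compensation formula on rectangles. *)
Lemma prm_mean (t : R) (A : set Omega) (B : set (R * E)) : 0 <= t -> F t A ->
  measurable B -> B `<=` D -> B `<=` [set x | t < x.1] ->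
  (\int[P]_(w in A) N w B = P A * m B)%E.
Proof.
move=> t0 FA mB BD Bt.
have mA : measurable A by exact: filtration_measurable usualF _ t0 _ FA.
have indep c : P (A `&` [set w | N w B = c]) = (P A * P [set w | N w B = c])%E.
  apply: (prm_future_indep prmN t0 FA); apply: sub_sigma_algebra.
  by exists B, [set c]; split => //; exact: emeasurable_set1.
have [mBoo|] := ltP (m B) +oo%E; last first.
  rewrite leye_eq => /eqP mBoo; rewrite mBoo.
  have mN1 := measurable_prm_level +oo%E mB.
  have PN1 := prm_infinite prmN mB BD mBoo.
  have PN0 : P (~` [set w | N w B = +oo%E]) = 0%E.
    by rewrite probability_setC// PN1 subee.
  rewrite (@ge0_ae_eq_integral _ _ _ _ _ _ (cst +oo%E))//.
  - rewrite integral_cst// muleC//.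
  - by apply: measurable_funTS; exact: measurable_kernel.
  - by move=> w _ /=; exact: le0y.
  - exists (~` [set w | N w B = +oo%E]); split; first exact: measurableC.
    + exact: PN0.
    + by move=> w; apply: contra_not => /= ->.
rewrite (integral_count (X := fun w => N w B))//; last 3 first.
- exact: measurable_kernel.
- by move=> w; exact: prm_integer prmN w _ mB BD.
- exact: prm_finite.
have PA : P A = (fine (P A))%:E by rewrite fineK// fin_num_measure.
have mBE : m B = (fine (m B))%:E by rewrite fineK// ge0_fin_numE.
rewrite (eq_eseriesr
  (g := fun k => (fine (P A))%:E *
    (k%:R%:E * poisson_prob (fine (m B)) k [set k]))%E); last first.
  move=> k _; rewrite muleCA -PA -(prm_poisson prmN mB BD mBoo).
  by congr (_ * _)%E; exact: indep.
rewrite nneseriesZl; last by move=> k _; rewrite mule_ge0// lee_fin.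
by rewrite poisson_mean ?fine_ge0// -PA -mBE.
Qed.

End poisson_random_measure_mean.

(** * Integration against the atoms of a random measure *)

(** The random measure [N] is only known to be a kernel, whereas the measurability
of [w |-> int f (w, x) N w (dx)] and the composition of kernels require
s-finiteness. Given disjoint measurable sets [F n], the kernel is cut into the
pieces [N (. & F n)] restricted to the event that the mass of [F n] lies in
[[j, j + 1[]; each piece is finite and their sum is s-finite. Nothing is lost
outside the event that some [F n] has infinite mass, which will be
negligible. *)
Section localized_kernel.
Context d d' (X : measurableType d) (Y : measurableType d') (R : realType).
Variables (k : R.-ker X ~> Y) (F : nat -> set Y).
Hypothesis mF : forall n, measurable (F n).

Definition mass_level n j : set X :=
  [set x | (j%:R%:E <= k x (F n) < j.+1%:R%:E)%E].

Lemma measurable_mass_level n j : measurable (mass_level n j).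
Proof.
have -> : mass_level n j =
    (fun x => k x (F n)) @^-1` `[j%:R%:E, j.+1%:R%:E[.
  by apply/seteqP; split => x /=; rewrite in_itv.
have := measurable_kernel k (F n) (mF n) measurableT.
by move=> /(_ _ (emeasurable_itv `[j%:R%:E, j.+1%:R%:E[)); rewrite setTI.
Qed.

Let level_ge0 n j x : 0 <= \1_(mass_level n j) x :> R.
Proof. by rewrite indicE. Qed.

Definition level_kernel n j (x : X) : {measure set Y -> \bar R} :=
  mscale (NngNum (level_ge0 n j x)) (mrestr (k x) (mF n)).

Let measurable_level_kernel n j U : measurable U ->
  measurable_fun [set: X] (level_kernel n j ^~ U).
Proof.
move=> mU; apply: emeasurable_funM.
  by apply/measurable_EFinP; apply/measurable_indic/measurable_mass_level.
by apply: measurable_kernel; exact: measurableI.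
Qed.

HB.instance Definition _ n j := isKernel.Build _ _ X Y R (level_kernel n j)
  (@measurable_level_kernel n j).

Let level_kernel_uub n j : measure_fam_uub (level_kernel n j).
Proof.
exists j.+1%:R => x; rewrite /level_kernel/= /mscale/= /mrestr setTI indicE.
have [|_] := boolP (x \in _); last by rewrite mul0e lte_fin ltr0n.
by rewrite inE => /andP[_]; rewrite mul1e.
Qed.

HB.instance Definition _ n j := Kernel_isFinite.Build _ _ X Y R
  (level_kernel n j) (@level_kernel_uub n j).

Definition localized_kernel : R.-sfker X ~> Y :=
  kseries (fun n => kseries (level_kernel n)).

Lemma localized_kernelE x U : trivIset setT F -> measurable U ->
  (forall n, k x (F n) < +oo)%E ->
  localized_kernel x U = k x (U `&` \bigcup_n F n).
Proof.
move=> tF mU Foo.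
rewrite setI_bigcupr measure_bigcup; last 2 first.
- by move=> n _; exact: measurableI.
- exact: trivIset_setIl.
rewrite [RHS](eq_eseriesl (Q := xpredT)); last by move=> n; rewrite in_setT.
apply: eq_eseriesr => n _.
have Fn : k x (F n) = (fine (k x (F n)))%:E by rewrite fineK// ge0_fin_numE.
have lvl j : (x \in mass_level n j) = (j == Num.truncn (fine (k x (F n)))).
  apply/idP/eqP => [|->]; rewrite inE /mass_level/= Fn !lee_fin lte_fin.
    by move=> h; apply/esym/truncn_def.
  by rewrite truncn_itv// fine_ge0.
rewrite /= /kseries/= /mseries (nneseriesD1 _ (n := Num.truncn (fine (k x (F n)))))//.
rewrite eseries0 ?adde0 => [|j _ /= jn].
  by rewrite /level_kernel /= /mscale/= indicE lvl eqxx mul1e.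
by rewrite /level_kernel /= /mscale/= indicE lvl (negbTE jn) mul0e.
Qed.

End localized_kernel.

Lemma integral_mrestr_supp d (T : measurableType d) (R : realType)
    (mu : {measure set T -> \bar R}) (D : set T) (mD : measurable D)
    (f : T -> \bar R) :
  (forall x, ~ D x -> f x = 0%E) ->
  (\int[mrestr mu mD]_x f x = \int[mu]_x f x)%E.
Proof.
move=> f0; have fD : f = f \_ D.
  by apply/funext => x; rewrite patchE; case: ifPn => // /negP; rewrite inE => /f0.
rewrite fD -!integral_mkcond; apply: eq_measure_integral => A mA AD.
by rewrite /= /mrestr setIidl.
Qed.

(** [joint_measure] is the measure [P(dw) N w (dx)] on the product of the sample
space and the mark space, [N] being replaced by its localized version
[point_measure]. Writing expected sums over atoms as integrals for one
measure on the product is what makes uniqueness of measures applicable. The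
factor [unit] only presents [P] as a kernel, so that the joint measure is a
composition of s-finite kernels. *)
Section disintegrated_measure.
Context d d' (Omega : measurableType d) (E : measurableType d') (R : realType).
Variables (P : probability Omega R) (N : R.-ker Omega ~> E) (F : nat -> set E).
Hypothesis mF : forall n, measurable (F n).

Definition unit_kernel (u : unit * Omega) : {measure set E -> \bar R} := N u.2.

Let measurable_unit_kernel U : measurable U ->
  measurable_fun [set: unit * Omega] (unit_kernel ^~ U).
Proof.
by move=> mU; exact: measurableT_comp (measurable_kernel N U mU) measurable_snd.
Qed.

HB.instance Definition _ := isKernel.Build _ _ _ _ _ unit_kernel
  measurable_unit_kernel.

Definition sample_kernel : R.-sfker unit ~> Omega :=
  kprobability (measurable_cst (P : pprobability Omega R)).

Let mpair : measurable_fun [set: (unit * Omega) * E]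
  (fun z => (z.1.2, z.2)).
Proof.
apply: measurable_fun_pair => /=; last exact: measurable_snd.
exact: measurableT_comp measurable_snd measurable_fst.
Qed.

Definition points_kernel : R.-sfker (unit * Omega) ~> E :=
  localized_kernel unit_kernel mF.

Definition point_measure (w : Omega) : {measure set E -> \bar R} :=
  points_kernel (tt, w).

Import KCOMP_SFINITE_KERNEL.

Definition graph_kernel : R.-sfker (unit * Omega) ~> (Omega * E)%type :=
  mkcomp points_kernel (kdirac mpair).

Definition joint_measure : {measure set (Omega * E) -> \bar R} :=
  mkcomp sample_kernel graph_kernel tt.

Lemma measurable_integral_point_measure (f : Omega * E -> \bar R) :
  (forall z, 0 <= f z)%E -> measurable_fun setT f ->
  measurable_fun setT (fun w => \int[point_measure w]_x f (w, x))%E.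
Proof.
move=> f0 mf.
pose g (z : (unit * Omega) * E) := f (z.1.2, z.2).
have mg : measurable_fun setT g by exact: measurableT_comp mf mpair.
have := measurable_fun_integral_sfinite_kernel g points_kernel
  (fun _ => f0 _) mg.
move=> h; exact: (measurableT_comp h (measurable_pair1 tt)).
Qed.

Lemma integral_joint_measure (f : Omega * E -> \bar R) :
  (forall z, 0 <= f z)%E -> measurable_fun setT f ->
  (\int[joint_measure]_z f z =
   \int[P]_w \int[point_measure w]_x f (w, x))%E.
Proof.
move=> f0 mf; rewrite /joint_measure [LHS]integral_kcomp//.
apply: eq_integral => w _; rewrite [LHS]integral_kcomp//.
by apply: eq_integral => x _; rewrite integral_dirac// diracT mul1e.
Qed.

Lemma point_measureE w U : trivIset setT F -> measurable U ->
  (forall n, N w (F n) < +oo)%E ->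
  point_measure w U = N w (U `&` \bigcup_n F n).
Proof. by move=> tF mU Foo; rewrite /point_measure /points_kernel localized_kernelE. Qed.

End disintegrated_measure.

(** Change of variables when the image measure formula for [mu] is known on the
subsets of [W] only. It is used for the jump measure [mu], which is the image
of [N] restricted to the accepted points under [(s, (y, gamma)) |-> (s, y)]. *)
Lemma integral_restricted_image d1 d2 (X : measurableType d1)
    (Y : measurableType d2) (R : realType) (nu : {measure set X -> \bar R})
    (mu : {measure set Y -> \bar R}) (phi : X -> Y) (S : set X) (W : set Y)
    (f : Y -> R) :
  measurable_fun setT phi -> measurable S -> measurable W ->
  measurable_fun setT f -> (forall y, 0 <= f y) ->
  S `<=` phi @^-1` W ->
  (forall A, measurable A -> A `<=` W -> mu A = nu (phi @^-1` A `&` S)) ->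
  (\int[mu]_(y in W) (f y)%:E = \int[nu]_x (f (phi x) * \1_S x)%:E)%E.
Proof.
move=> mphi mS mW mf f0 SW muE.
have mphiW : measurable (phi @^-1` W) by rewrite -[_ @^-1` _]setTI; exact: mphi.
have mfE : measurable_fun setT (EFin \o f) by exact/measurable_EFinP.
pose nuS : {measure set X -> \bar R} := mrestr nu mS.
transitivity (\int[pushforward nuS phi]_(y in W) (f y)%:E)%E.
  by apply: eq_measure_integral => A mA AW; exact: muE.
rewrite (@ge0_integral_pushforward _ _ _ _ _ phi mphi nuS W)//; last 2 first.
- exact: measurable_funTS.
- by move=> y _; rewrite lee_fin.
rewrite -(integral_mrestr_supp nu mS); last first.
  by move=> x Sx; rewrite indicE memNset ?mulr0.
rewrite [RHS](_ : _ = \int[nuS]_(x in phi @^-1` W) (f (phi x) * \1_S x)%:E)%E.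
  apply: ge0_ae_eq_integral => //.
  - by apply: measurable_funTS; exact: measurableT_comp mfE mphi.
  - apply/measurable_EFinP; apply: measurable_funM.
      by apply: measurable_funTS; exact: measurableT_comp mf mphi.
    exact: measurable_indic.
  - by move=> x _; rewrite lee_fin.
  - by move=> x _; rewrite lee_fin mulr_ge0.
  exists (~` S); split; first exact: measurableC.
    by rewrite /nuS/= /mrestr setICl measure0.
  by move=> x; apply: contra_not => Sx _; rewrite /= indicE mem_set ?mulr1.
rewrite integral_mkcond; apply: eq_integral => x _.
rewrite patchE; case: ifPn => // /negP xW.
by rewrite indicE memNset ?mulr0// => /SW xW'; apply: xW; rewrite inE.
Qed.

(** * Predictable processes and the compensation formula *)

Section predictable_sigma_algebra.
Context d (Omega : measurableType d) (R : realType) d' (E : measurableType d').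
Variable F : R -> set (set Omega).

(** Intervals may start at a negative time, the information being then that of
time 0; the rectangles thus cover the whole product and form a pi-system. *)
Definition predictable_rect : set (set (Omega * (R * E))) :=
  [set C | exists A (s t : R) (B : set E),
    [/\ F (Num.max 0 s) A, measurable B & C = A `*` (`]s, t]%classic `*` B)]].

Definition predictable := g_sigma_algebraType predictable_rect.

Hypothesis F_sigma : forall t : R, 0 <= t -> sigma_algebra [set: Omega] (F t).
Hypothesis F_mono : forall s t : R, 0 <= s -> s <= t -> F s `<=` F t.
Hypothesis F_meas : forall t : R, 0 <= t -> F t `<=` measurable.

Let max0 (s : R) : 0 <= Num.max 0 s. Proof. by rewrite le_max lexx. Qed.

Lemma predictable_rect_setI : setI_closed predictable_rect.
Proof.
move=> _ _ [A1 [s1 [t1 [B1 [FA1 mB1 ->]]]]] [A2 [s2 [t2 [B2 [FA2 mB2 ->]]]]].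
exists (A1 `&` A2), (Num.max s1 s2), (Num.min t1 t2), (B1 `&` B2); split.
- have h i s' : F (Num.max 0 s') i -> s' <= Num.max s1 s2 ->
      F (Num.max 0 (Num.max s1 s2)) i.
    by move=> Fi ss'; apply: F_mono Fi; rewrite ?max0// le_max2 ?lexx.
  have [F0 Fc Fu] := F_sigma (max0 (Num.max s1 s2)).
  pose GT := g_sigma_algebraType (F (Num.max 0 (Num.max s1 s2))).
  have GE : @measurable _ GT = F (Num.max 0 (Num.max s1 s2)).
    by apply: sigma_algebra_id; exact: F_sigma.
  rewrite -GE; apply: (@measurableI _ GT); rewrite GE.
    by apply: h FA1 _; rewrite le_max lexx.
  by apply: h FA2 _; rewrite le_max lexx orbT.
- exact: measurableI.
- rewrite -!setXI; congr (_ `*` (_ `*` _)).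
  apply/seteqP; split => x; rewrite /= !in_itv/= gt_max le_min.
    by move=> [/andP[-> ->] /andP[-> ->]].
  by move=> /andP[/andP[-> ->] /andP[-> ->]].
Qed.

Lemma predictable_rect_measurable : predictable_rect `<=` measurable.
Proof.
move=> _ [A [s [t [B [FA mB ->]]]]].
apply: measurableX; first exact: F_meas FA.
by apply: measurableX.
Qed.

Lemma measurable_predictable_id :
  measurable_fun [set: Omega * (R * E)] (id : Omega * (R * E) -> predictable).
Proof.
move=> _ B mB; rewrite setTI.
exact: (smallest_sub (sigma_algebra_measurable _) predictable_rect_measurable).
Qed.

Lemma measurable_predictable_fun d0 (T : measurableType d0)
    (f : Omega * (R * E) -> T) :
  measurable_fun setT (f : predictable -> T) -> measurable_fun setT f.
Proof.
move=> mf _ B mB; have := mf measurableT _ mB; rewrite !setTI => fB.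
exact: (smallest_sub (sigma_algebra_measurable _) predictable_rect_measurable)
  fB.
Qed.

Lemma predictable_integral_eq (m1 m2 : {measure set (Omega * (R * E)) -> \bar R})
    (f : predictable -> \bar R) :
  (forall U, <<s predictable_rect >> U -> m1 U = m2 U) ->
  (forall z, 0 <= f z)%E -> measurable_fun setT f ->
  (\int[m1]_z f z = \int[m2]_z f z)%E.
Proof.
move=> m12 f0 mf.
have mid : measurable_fun [set: Omega * (R * E)] (id : _ -> predictable).
  exact: measurable_predictable_id.
have h m := @ge0_integral_pushforward _ _ _ predictable R _ mid m setT f
  measurableT mf (fun y _ => f0 y).
transitivity (\int[m1]_(z in id @^-1` [set: predictable]) (f \o id) z)%E => //.
rewrite -(h m1); transitivity (\int[pushforward m2 (id : _ -> predictable)]_z f z)%E.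
  by apply: eq_measure_integral => A mA _; exact: m12.
exact: h m2.
Qed.

End predictable_sigma_algebra.

(** [Q] exhausts the mark space in such a way that the boxes [ ]-n, n] x Q n] have
finite intensity; the atoms at positive times are then separated into
countably many cells of almost surely finite mass. *)
Section compensator.
Context d (Omega : measurableType d) (R : realType) d' (E : measurableType d').
Variables (P : probability Omega R) (F : R -> set (set Omega)).
Variables (D : set (R * E)) (m : {sigma_finite_measure set (R * E)%type -> \bar R}).
Variable N : R.-ker Omega ~> (R * E)%type.
Hypothesis usualF : usual_conditions P F.
Hypothesis prmN : poisson_random_measure P F D m N.
Hypothesis mD : measurable D.
Variable Q : nat -> set E.
Hypothesis mQ : forall n, measurable (Q n).
Hypothesis ndQ : nondecreasing_seq Q.
Hypothesis Q_cover : \bigcup_n Q n = setT.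
Definition box n : set (R * E) := `]- n%:R, n%:R]%classic `*` Q n.
Hypothesis box_finite : forall n, (m (box n) < +oo)%E.

Definition future_domain : set (R * E) := D `&` [set x | 0 < x.1].

Lemma measurable_future_domain : measurable future_domain.
Proof.
apply: measurableI => //.
rewrite (_ : [set _ | _] = `]0, +oo[%classic `*` setT); first exact: measurableX.
by apply/seteqP; split => x /=; rewrite in_itv/= andbT; [split|case].
Qed.

Lemma measurable_box n : measurable (box n).
Proof. exact: measurableX. Qed.

Lemma box_cover : \bigcup_n box n = setT.
Proof.
rewrite -subTset => -[s y] _.
have : [set: E] y by []; rewrite -Q_cover => -[i _ Qiy].
pose j := (Num.truncn `|s|).+1; exists (maxn i j) => //; split => /=; last first.
  by move: Qiy; apply/subsetPset/ndQ/leq_maxl.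
have : `|s| < (maxn i j)%:R.
  by rewrite (lt_le_trans (truncnS_gt _))// ler_nat leq_maxr.
by rewrite ltr_norml in_itv/= => /andP[-> /ltW].
Qed.

Definition cells : nat -> set (R * E) :=
  seqDU (fun n => future_domain `&` box n).

Lemma measurable_cells n : measurable (cells n).
Proof.
by apply: seqDU_measurable => i; apply: measurableI;
  [exact: measurable_future_domain|exact: measurable_box].
Qed.

Lemma trivIset_cells : trivIset setT cells.
Proof. exact: trivIset_seqDU. Qed.

Lemma bigcup_cells : \bigcup_n cells n = future_domain.
Proof. by rewrite -seqDU_bigcup_eq -setI_bigcupr box_cover setIT. Qed.

Lemma cells_finite : {ae P, forall w, forall n, (N w (cells n) < +oo)%E}.
Proof.
apply/ae_foralln => n.
have mC := measurable_cells n.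
have CD : cells n `<=` D by move=> x []; case => -[].
exists [set w | N w (cells n) = +oo%E]; split.
- exact: measurable_prm_level.
- apply: (prm_finite prmN) => //; apply: le_lt_trans (box_finite n).
  by apply: le_measure; rewrite ?inE//; [exact: measurable_box|move=> x [[]]].
- by move=> w /= /negP; rewrite -leNgt leye_eq => /eqP.
Qed.

Local Notation pm := (point_measure N measurable_cells).

Lemma point_measure_prm :
  {ae P, forall w, forall U, measurable U -> pm w U = N w (U `&` future_domain)}.
Proof.
apply: filterS cells_finite => w Nw U mU.
by rewrite point_measureE// ?bigcup_cells//; exact: trivIset_cells.
Qed.

(** On a rectangle the joint measure is the expectation over [A] of the mass of
the part of [ ]s, t] x B] at positive times, which lies strictly after
[max 0 s]: [prm_mean] applies. *)
Lemma joint_measure_rect U : predictable_rect F U ->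
  joint_measure P N measurable_cells U =
  mrestr (P \x m)%E (measurableX measurableT measurable_future_domain) U.
Proof.
move=> PU; have mU : measurable U.
  exact: predictable_rect_measurable (filtration_measurable usualF) _ PU.
have [A [s [t [B [FA mB UE]]]]] := PU.
have s0 : 0 <= Num.max 0 s by rewrite le_max lexx.
have mA : measurable A by exact: filtration_measurable usualF _ s0 _ FA.
have mC : measurable (`]s, t]%classic `*` B) by exact: measurableX.
have mCD := measurableI _ _ mC measurable_future_domain.
rewrite /mrestr UE -setXI setIT product_measure1E//.
rewrite -(prm_mean usualF prmN s0 FA)//; last 2 first.
- by move=> x [_ []].
- move=> x [[/= ]]; rewrite in_itv/= => /andP[sx _] _ [_ /= x0].
  by rewrite gt_max x0.
pose f (z : Omega * (R * E)) : \bar R := (\1_(A `*` (`]s, t]%classic `*` B)) z)%:E.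
have mf : measurable_fun setT f.
  by apply/measurable_EFinP; apply: measurable_indic; exact: measurableX.
have f0 z : (0 <= f z)%E by rewrite lee_fin.
transitivity (\int[joint_measure P N measurable_cells]_z f z)%E.
  by rewrite integral_indic ?setIT//; exact: measurableX.
rewrite integral_joint_measure// [RHS]integral_mkcond.
apply: ge0_ae_eq_integral => //.
- exact: measurable_integral_point_measure.
- by apply/(measurable_restrictT _ _).1 => //; apply: measurable_funTS; exact: measurable_kernel.
- by move=> w _; exact: integral_ge0.
- by move=> w _; rewrite patchE; case: ifP.
- apply: filterS point_measure_prm => w Nw _.
  rewrite patchE; case: ifPn => wA.
    rewrite -Nw// -[in RHS](setIT (_ `*` B)) -integral_indic//.
    apply: eq_integral => x _; rewrite /f !indicE; congr (_%:R%:E).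
    by rewrite in_setX wA.
  apply: integral0_eq => x _; rewrite /f indicE memNset// => -[/= ].
  by move: wA; rewrite notin_setE.
Qed.

(** The joint measure and the product measure agree on the pi-system of
predictable rectangles and are sigma-finite along the boxes, so they agree on
the predictable sigma-algebra, and integrate predictable functions alike. *)
Lemma compensation_formula (H : Omega * (R * E) -> \bar R) :
  (forall z, 0 <= H z)%E ->
  measurable_fun setT (H : predictable E F -> \bar R) ->
  (forall w x, ~ future_domain x -> H (w, x) = 0%E) ->
  (\int[P]_w \int[pm w]_x H (w, x) = \int[P \x m]_z H z)%E.
Proof.
move=> H0 mH HD.
have Fmeas := filtration_measurable usualF.
have mH' : measurable_fun setT H.
  exact: measurable_predictable_fun Fmeas _ _ _ mH.
rewrite -integral_joint_measure//.
rewrite -(integral_mrestr_supp (P \x m)%E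
  (measurableX measurableT measurable_future_domain)); last first.
  by move=> [w x] wx; apply: HD => Dx; apply: wx.
apply: (predictable_integral_eq Fmeas) => //.
(* the boxes are symmetric in time so that they exhaust the product *)
have Gbox n : predictable_rect F (setT `*` box n).
  exists setT, (- n%:R), n%:R, (Q n); split => //.
  have s0 : 0 <= Num.max 0 (- n%:R) :> R by rewrite le_max lexx.
  have [F0 Fc _] := filtration_sigma_algebra usualF s0.
  by rewrite -(setD0 setT); exact: Fc.
apply: (@g_sigma_algebra_measure_unique _ _ _ (predictable_rect F) _
  (fun n => setT `*` box n)) => //.
- exact: predictable_rect_measurable.
- by rewrite -setX_bigcupr box_cover setXTT.
- apply: predictable_rect_setI => [t t0|s t s0 st].
  + exact (filtration_sigma_algebra usualF t0).
  + exact (filtration_mono usualF s0 st).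
- exact: joint_measure_rect.
- move=> n; rewrite joint_measure_rect// /mrestr.
  have mB : measurable (setT `*` box n : set (Omega * (R * E))).
    by apply: measurableX => //; exact: measurable_box.
  have mBD := measurableI _ _ mB
    (measurableX measurableT measurable_future_domain).
  have PB : ((P \x m) (setT `*` box n) < +oo)%E.
    have Pm : (P setT * m (box n) < +oo)%E.
      by rewrite probability_setT mul1e; exact: box_finite.
    by rewrite product_measure1E//; exact: measurable_box.
  exact: le_lt_trans (le_measure (P \x m)%E (mem_set mBD) (mem_set mB)
    (@subIsetl _ _ _)) PB.
Qed.

End compensator.

(** [grid n s] is the left endpoint of the cell of mesh [1 / (n + 1)] containing
[s > 0]. The cells are open on the left, so that [grid n s < s] and a process
sampled at [grid n s] is predictable. *)
Section grid.
Context {R : realType}.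
Implicit Types (s : R) (n k : nat).

Definition grid n s : R := `|Num.ceil (s * n.+1%:R) - 1|%N%:R / n.+1%:R.

Definition grid_cell n k : set R := `]k%:R / n.+1%:R, k.+1%:R / n.+1%:R]%classic.

Lemma gridE n k s : grid_cell n k s -> grid n s = k%:R / n.+1%:R.
Proof.
rewrite /grid_cell/= in_itv/= ltr_pdivrMr// ler_pdivlMr// => sk.
have k1 : k.+1%:Z - 1 = k%:Z by rewrite -addn1 PoszD addrK.
by rewrite /grid (@ceil_def _ _ k.+1%:Z) k1.
Qed.

Lemma grid_cell_ex n s : 0 < s -> exists k, grid_cell n k s.
Proof.
move=> s0; have sn0 : 0 < s * n.+1%:R by rewrite mulr_gt0.
have ci := ceil_itv (s * n.+1%:R).
have c1 : (0 <= Num.ceil (s * n.+1%:R) - 1)%R.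
  by rewrite subr_ge0 -gtz0_ge1 ceil_gt0.
exists `|Num.ceil (s * n.+1%:R) - 1|%N.
rewrite /grid_cell/= in_itv/= ltr_pdivrMr// ler_pdivlMr//.
move: (Num.ceil _) c1 ci => c c1 ci.
have cE : `|c - 1|%N%:R = (c - 1)%:~R :> R by rewrite natr_absz ger0_norm.
rewrite -[X in _ && (_ <= X)]natr1 cE.
by rewrite -[1 in X in _ && (_ <= X)]/(1%:~R) -intrD subrK.
Qed.

Lemma grid_lt n s : 0 < s -> grid n s < s <= grid n s + n.+1%:R^-1.
Proof.
move=> /(grid_cell_ex n)[k sk]; rewrite (gridE sk).
by move: sk; rewrite /grid_cell/= in_itv/= -[X in _ <= X / _]natr1 mulrDl mul1r.
Qed.

Lemma cvg_grid s : 0 < s -> grid n s @[n --> \oo] --> s.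
Proof.
move=> s0.
apply: (@squeeze_cvgr _ _ _ _ (fun n => s - n.+1%:R^-1) (cst s)).
- near=> n; have /andP[l r] := grid_lt n s0.
  by rewrite lerBlDr r (ltW l).
- rewrite -[X in _ --> X]subr0; apply: cvgB; first exact: cvg_cst.
  exact: cvg_harmonic.
- exact: cvg_cst.
Unshelve. all: by end_near. Qed.

End grid.

Section predictable_processes.
Context d (Omega : measurableType d) (R : realType) d' (E : measurableType d').
Variable F : R -> set (set Omega).
Hypothesis F_sigma : forall t : R, 0 <= t -> sigma_algebra [set: Omega] (F t).
Local Notation pred := (predictable E F).

Lemma predictable_time_mark (s t : R) (B : set E) : measurable B ->
  measurable ((setT `*` (`]s, t]%classic `*` B)) : set pred).
Proof.
move=> mB; apply: sub_sigma_algebra; exists setT, s, t, B; split => //.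
have s0 : 0 <= Num.max 0 s by rewrite le_max lexx.
by have [F0 Fc _] := F_sigma s0; rewrite -(setD0 setT); exact: Fc.
Qed.

Lemma measurable_predictable_time :
  measurable_fun setT (fun z : pred => z.2.1).
Proof.
apply: (measurability _ (RGenOInfty.measurableE R)) => _ [_ [x ->] <-].
rewrite setTI (_ : _ @^-1` _ =
    \bigcup_n (setT `*` (`]x, n%:R]%classic `*` setT))); last first.
  apply/seteqP; split => [[w [s y]] /=|[w [s y]] [n _] [_ []]/=].
    rewrite in_itv/= andbT => xs.
    exists (Num.truncn s).+1 => //; split => //; split => //=.
    by rewrite in_itv/= xs ltW// truncnS_gt.
  by rewrite !in_itv/= andbT => /andP[].
by apply: bigcupT_measurable => n; exact: predictable_time_mark.
Qed.

Lemma measurable_predictable_mark :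
  measurable_fun setT (fun z : pred => z.2.2).
Proof.
move=> _ B mB; rewrite setTI (_ : _ @^-1` _ =
    \bigcup_n (setT `*` (`]- n%:R, n%:R]%classic `*` B))); last first.
  apply/seteqP; split => [[w [s y]] /= By|[w [s y]] [n _] [_ []]//=].
  exists (Num.truncn `|s|).+1 => //; split => //; split => //=.
  have := truncnS_gt `|s|; rewrite ltr_norml => /andP[? ?].
  by rewrite in_itv/= ltW// andbT.
by apply: bigcupT_measurable => n; exact: predictable_time_mark.
Qed.

Lemma measurable_predictable_step (X : R -> Omega -> R) n : adapted F X ->
  measurable_fun setT
    (fun z : pred => if 0 < z.2.1 then X (grid n z.2.1) z.1 else 0).
Proof.
move=> adX; apply: measurable_fun_if => //.
  by apply: measurable_fun_ltr => //; exact: measurable_predictable_time.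
rewrite setTI (_ : _ @^-1` _ =
    \bigcup_k (setT `*` (grid_cell n k `*` setT))); last first.
  apply/seteqP; split => [[w [s y]] /= s0|[w [s y]] [k _] [_ []]/=].
    by have [k sk] := grid_cell_ex n s0; exists k.
  rewrite /grid_cell/= in_itv/= => /andP[+ _] _.
  by apply: le_lt_trans; rewrite divr_ge0.
apply/measurable_fun_bigcup => k; first exact: predictable_time_mark.
move=> _ B mB.
rewrite (_ : _ `&` _ =
    (X (k%:R / n.+1%:R) @^-1` B) `*` (grid_cell n k `*` setT)); last first.
  apply/seteqP; split => [[w [s y]] [[_ [/= sk _]]]|[w [s y]] [/= XB [sk _]]].
    by rewrite (gridE sk).
  by split => //=; rewrite (gridE sk).
have k0 : 0 <= k%:R / n.+1%:R :> R by rewrite divr_ge0.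
apply: sub_sigma_algebra; exists (X (k%:R / n.+1%:R) @^-1` B),
  (k%:R / n.+1%:R), (k.+1%:R / n.+1%:R), setT; split => //.
by rewrite max_r//; exact: adX.
Qed.

(** The left limit at [s] is the limit of the values at the grid points, which
stay strictly below [s] and tend to [s]. *)
Lemma measurable_predictable_left_limit (X : R -> Omega -> R) : adapted F X ->
  (forall w, cadlag (X ^~ w)) ->
  measurable_fun setT
    (fun z : pred => if 0 < z.2.1 then left_limit (X ^~ z.1) z.2.1 else 0).
Proof.
move=> adX cX; apply: (measurable_fun_cvg
  (h := fun n (z : pred) => if 0 < z.2.1 then X (grid n z.2.1) z.1 else 0)) => [n|].
  exact: measurable_predictable_step.
move=> [w [s y]] _ /=; case: ifPn => [s0|_]; last exact: cvg_cst.
rewrite /left_limit gt_eqF//.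
have [_ /(_ s s0)] := cX w; move/cvg_at_leftP; apply; split.
  by move=> n; have /andP[] := grid_lt n s0.
exact: cvg_grid.
Qed.

End predictable_processes.

Section cadlag_measurable.
Context d (Omega : measurableType d) (R : realType).
Variable X : R -> Omega -> R.
Hypothesis mX : forall t : R, 0 <= t -> measurable_fun setT (X t).
Hypothesis cX : forall w, cadlag (X ^~ w).

(** Right-continuity makes the process the limit of its values at the grid shifted
to the right. Joint measurability of the approximations is the predictability
of a step process for the constant filtration. *)
Lemma measurable_cadlag :
  measurable_fun setT (fun z : Omega * R => if 0 < z.2 then X z.2 z.1 else 0).
Proof.
pose F (t : R) : set (set Omega) := measurable.
have F_sigma (t : R) : 0 <= t -> sigma_algebra setT (F t).
  by move=> _; exact: sigma_algebra_measurable.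
apply: (measurable_fun_cvg (h := fun n (z : Omega * R) =>
  if 0 < z.2 then X (grid n z.2 + 2 / n.+1%:R) z.1 else 0)) => [n|].
  (* one mesh would only give a point not before [s]; two meshes give a point
     strictly after [s], as the one-sided limit requires *)
  pose Y t w := X (t + 2 / n.+1%:R) w.
  have adY : adapted F Y.
    move=> t t0 A mA; rewrite -[_ @^-1` _]setTI; apply: mX => //.
    by rewrite addr_ge0// divr_ge0.
  have := @measurable_predictable_step _ _ _ _ unit F F_sigma Y n adY.
  move=> /measurable_predictable_fun mY.
  have mp : measurable_fun setT (fun z : Omega * R => (z.1, (z.2, tt))).
    apply: measurable_fun_pair => //; apply: measurable_fun_pair => //.
  exact: (measurableT_comp (mY (fun _ _ _ => id)) mp).
move=> [w s] _ /=; case: ifPn => [s0|_]; last exact: cvg_cst.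
have [/(_ s (ltW s0)) + _] := cX w; move/cvg_at_rightP; apply; split.
  move=> n; have /andP[_] := grid_lt n s0.
  by move=> /le_lt_trans; apply; rewrite ltrD2l ltr_pdivlMr// mulVf// ltr1n.
rewrite -[X in _ --> X]addr0; apply: cvgD; first exact: cvg_grid.
by rewrite -(mulr0 2); apply: cvgM; [exact: cvg_cst|exact: cvg_harmonic].
Qed.

End cadlag_measurable.

(** * Expected jumps of the activity process *)

Section default_borel_intensity.
Context {R : realType}.
Local Notation TR := (measurableTypeR R).

(** The same set function as [thinning_intensity], on the measurable structure
that the product of the real line carries by default and on which the random
measures are kernels; the two sigma-algebras are convertible. *)
Definition intensity_default (th : tempered_param R) :
    set (R * (R * R)) -> \bar R := thinning_intensity th.

Let mid : measurable_fun [set: TR * (TR * TR)]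
  (id : TR * (TR * TR) -> R * (R * R)).
Proof. by move=> _ B mB; rewrite setTI. Qed.

Let intensity_default0 th : intensity_default th set0 = 0%E.
Proof. exact: (measure0 (thinning_intensity th)). Qed.

Let intensity_default_ge0 th A : (0 <= intensity_default th A)%E.
Proof. exact: (measure_ge0 (thinning_intensity th)). Qed.

Let intensity_default_sigma_additive th :
  semi_sigma_additive (intensity_default th).
Proof. exact: (@measure_semi_sigma_additive _ _ _ (thinning_intensity th)). Qed.

HB.instance Definition _ th := isMeasure.Build _ _ _ (intensity_default th)
  (intensity_default0 th) (intensity_default_ge0 th)
  (@intensity_default_sigma_additive th).

Let intensity_default_sigma_finite th :
  sigma_finite setT (intensity_default th).
Proof. exact: (sigma_finiteT (thinning_intensity th)). Qed.

HB.instance Definition _ th := Measure_isSigmaFinite.Build _ _ _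
  (intensity_default th) (intensity_default_sigma_finite th).

Lemma integral_intensity_default th (f : R * (R * R) -> \bar R) :
  (forall x, 0 <= f x)%E -> measurable_fun setT f ->
  (\int[intensity_default th]_x f x =
   \int[lebesgue_measure]_s \int[levy_measure th]_y
     \int[lebesgue_measure]_c f (s, (y, c)))%E.
Proof.
move=> f0 mf.
have mf' : measurable_fun [set: TR * (TR * TR)] (f : TR * (TR * TR) -> \bar R).
  exact: mf.
transitivity (\int[thinning_intensity th]_x f x)%E.
  have := @ge0_integral_pushforward _ _ _ _ _ _ mid (thinning_intensity th)
    setT f measurableT mf (fun y _ => f0 y).
  by move=> <-; apply: eq_measure_integral.
rewrite /thinning_intensity fubini_tonelli1//.
apply: eq_integral => s _; rewrite /fubini_F /mark_measure fubini_tonelli1//.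
exact: measurable_fun_pair2.
Qed.

End default_borel_intensity.

Lemma mark_exhaustion (R : realType) (th : tempered_param R) :
  exists Q : nat -> set (R * R), [/\ forall n, measurable (Q n),
    nondecreasing_seq Q, \bigcup_n Q n = setT &
    forall n, (intensity_default th (box Q n) < +oo)%E].
Proof.
have /sigma_finiteP[Q [QT ndQ Qoo]] := sigma_finiteT (mark_measure th).
exists Q; split => // [n|n]; have [mQ Qn] := Qoo n; first exact: mQ.
pose I : set (measurableTypeR R) := `]- n%:R, n%:R]%classic.
have Ioo : (lebesgue_measure I < +oo)%E.
  by rewrite lebesgue_measure_itv/=; case: ifPn => _; rewrite ltry.
have := @product_measure1E _ _ _ _ _ (@lebesgue_measure R) (mark_measure th)
  I (Q n) (measurable_itv _) mQ.
rewrite /intensity_default /thinning_intensity /box => ->.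
by rewrite lte_mul_pinfty// ge0_fin_numE.
Qed.

Section activity_jumps.
Context (R : realType) (th : tempered_param R) (kappa lbar eta a : R).
Context d (Omega : measurableType d) (P : probability Omega R).
Variables (F : R -> set (set Omega)) (N : R.-ker Omega ~> (R * (R * R))%type).
Variables (lambda : R -> Omega -> R) (mu : R.-ker Omega ~> (R * R)%type).
Hypothesis a_ge0 : 0 <= a.
Hypothesis ap : activity_process th kappa lbar eta a P F N lambda mu.

Local Notation ll w s := (left_limit (lambda ^~ w) s).

Lemma activity_kernel_ge0 (y : R) : 0 <= activity_kernel a y.
Proof. by rewrite subr_ge0 expR_le1 oppr_le0 mulr_ge0// sqr_ge0. Qed.

Lemma measurable_activity_kernel : measurable_fun setT (activity_kernel a).
Proof.
apply: measurable_funB => //; apply: measurableT_comp => //.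
by apply: measurableT_comp => //; exact: measurable_funM.
Qed.

Lemma left_limit_ge0 w s : 0 < s -> 0 <= ll w s.
Proof.
move=> s0; rewrite /left_limit gt_eqF//.
have [_ /(_ s s0) cs] := ap_cadlag ap w.
apply: limr_ge => //; near=> t; apply: (ap_ge0 ap).
near: t; exact: nbhs_left_ge.
Unshelve. all: by end_near. Qed.

(** The points of the sample space times the mark space that are kept by the
thinning. Membership compares [gamma] with the left limit only, so the set is
predictable. *)
Definition accepted (T : R) : set (Omega * (R * (R * R))) :=
  [set z | [/\ 0 < z.2.1, z.2.1 <= T, z.2.2.1 != 0, 0 <= z.2.2.2 &
               z.2.2.2 <= ll z.1 z.2.1]].

Lemma measurable_accepted (T : R) :
  measurable (accepted T : set (predictable (R * R)%type F)).
Proof.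
have Fs := filtration_sigma_algebra (ap_usual ap).
have mt := measurable_predictable_time (E := (R * R)%type) Fs.
have my := measurable_predictable_mark (E := (R * R)%type) Fs.
have mll := measurable_predictable_left_limit (E := (R * R)%type) Fs
  (ap_adapted ap) (ap_cadlag ap).
have my1 := measurableT_comp measurable_fst my.
have my2 := measurableT_comp measurable_snd my.
have m1 := mt measurableT _ (measurable_itv `]0, T]).
have m2 := my1 measurableT _ (measurableC (measurable_set1 0)).
have m3 := my2 measurableT _ (measurable_itv `[0, +oo[).
have m4 := measurable_fun_ler my2 mll measurableT
  (Y := [set true]) I.
rewrite !setTI in m1 m2 m3 m4.
have m12 := measurableI _ _ m1 m2.
have m34 := measurableI _ _ m3 m4.
have := measurableI _ _ m12 m34.
set S := (X in measurable X); suff -> : accepted T = S by [].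
rewrite /S; apply/seteqP; split => -[w [s [y c]]]; rewrite /accepted/= !in_itv/= ?andbT.
  by move=> [s0 sT /eqP y0 c0 cl]; rewrite s0 sT c0.
by move=> [[/andP[s0 ->] /eqP y0] [c0]]; rewrite s0.
Qed.

Definition jump_gain (T : R) (z : Omega * (R * (R * R))) : \bar R :=
  (activity_kernel a z.2.2.1 * \1_(accepted T) z)%:E.

Lemma jump_gain_ge0 T z : (0 <= jump_gain T z)%E.
Proof. by rewrite lee_fin mulr_ge0// activity_kernel_ge0. Qed.

Lemma measurable_jump_gain T :
  measurable_fun setT (jump_gain T : predictable (R * R)%type F -> \bar R).
Proof.
have Fs := filtration_sigma_algebra (ap_usual ap).
have my := measurable_predictable_mark (E := (R * R)%type) Fs.
apply/measurable_EFinP; apply: measurable_funM.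
  exact: (measurableT_comp measurable_activity_kernel
    (measurableT_comp measurable_fst my)).
apply: measurable_indic; exact: measurable_accepted.
Qed.

(** Integrating out [gamma] gives the length of [[0, lambda_(s-)]], which turns the
intensity of [N] into that of the jumps. *)
Lemma jump_gain_compensator T w s :
  (\int[levy_measure th]_(y in [set y : R | (y != 0)%R])
     (activity_kernel a y)%:E = (gbar th a)%:E)%E ->
  (\int[levy_measure th]_y \int[lebesgue_measure]_c jump_gain T (w, (s, (y, c)))
   = (\1_(`]0%R, T]%classic) s * (gbar th a * ll w s))%:E)%E.
Proof.
move=> gE; have [sT|sT] := boolP (s \in `]0, T]); last first.
  rewrite indicE memNset; last by apply/negP.
  rewrite mul0r integral0_eq// => y _; apply: integral0_eq => c _.
  rewrite /jump_gain indicE memNset ?mulr0//= => -[/= s0 sT' _ _ _].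
  by move/negP: sT; apply; rewrite in_itv/= s0.
have /andP[s0 sT'] : 0 < s <= T by move: sT; rewrite in_itv.
rewrite indicE mem_set// mul1r.
pose D : set R := [set y | y != 0].
have mD : measurable D.
  rewrite (_ : D = ~` [set 0]); first exact: measurableC.
  by apply/seteqP; split => y /eqP.
have lI : (lebesgue_measure (`[0%R, ll w s]%classic : set R) = (ll w s)%:E)%E.
  rewrite lebesgue_measure_itv/= lte_fin.
  have := left_limit_ge0 w s0; rewrite le_eqVlt => /predU1P[<-|->].
    by rewrite ltxx.
  by rewrite oppr0 adde0.
transitivity (\int[levy_measure th]_y
    ((ll w s)%:E * (activity_kernel a y * \1_D y)%:E))%E.
  apply: eq_integral => y _.
  transitivity (\int[lebesgue_measure]_c
      ((activity_kernel a y * \1_D y)%:E * (\1_(`[0, ll w s]%classic) c)%:E))%E.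
    apply: eq_integral => c _; rewrite /jump_gain -EFinM -mulrA.
    congr (_ * _)%:E; rewrite !indicE -natrM mulnb; congr ((nat_of_bool _)%:R).
    apply/idP/andP; rewrite !inE/= in_itv/=.
      by move=> [_ _ y0 c0 cl]; rewrite c0.
    by move=> [y0 /andP[c0 cl]].
  rewrite ge0_integralZl//; last 2 first.
  - by apply/measurable_EFinP; apply: measurable_indic.
  - by rewrite lee_fin mulr_ge0// activity_kernel_ge0.
  by rewrite integral_indic// setIT [X in (_ * X)%E]lI muleC.
rewrite ge0_integralZl//; last 3 first.
- apply/measurable_EFinP; apply: measurable_funM; last exact: measurable_indic.
  exact: measurable_activity_kernel.
- by move=> y _; rewrite lee_fin mulr_ge0// activity_kernel_ge0.
- by rewrite lee_fin left_limit_ge0.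
rewrite mulrC EFinM -gE [in RHS]integral_mkcond; congr (_ * _)%E.
apply: eq_integral => y _; rewrite patchE indicE.
by case: ifPn => _; rewrite ?mulr1 ?mulr0.
Qed.

Definition jump_window (T : R) : set (R * R) :=
  [set z : R * R | [/\ 0 < z.1, z.1 <= T & z.2 != 0]].

Lemma measurable_jump_window T : measurable (jump_window T).
Proof.
rewrite (_ : jump_window T = `]0, T]%classic `*` (~` [set 0])).
  by apply: measurableX => //; exact: measurableC.
apply/seteqP; split => -[s y]; rewrite /jump_window/= in_itv/=.
  by move=> [-> -> /eqP].
by move=> [/andP[-> ->] /eqP].
Qed.

Lemma measurable_mark_domain : measurable (@mark_domain R).
Proof.
rewrite (_ : mark_domain = `[0, +oo[%classic `*` (~` [set 0] `*` `[0, +oo[%classic)).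
  by apply: measurableX => //; apply: measurableX => //; exact: measurableC.
apply/seteqP; split => -[s [y c]]; rewrite /mark_domain/= !in_itv/= !andbT.
  by move=> [-> /eqP].
by move=> [-> [/eqP]].
Qed.

(** The jump sum is almost surely the integral of a predictable function against
the atoms of [N]. The variable [J] is a version of it that is measurable for
every sample point, which the jump measure [mu] does not provide by itself. *)
Lemma expected_jumps T :
  (\int[levy_measure th]_(y in [set y : R | (y != 0)%R])
     (activity_kernel a y)%:E = (gbar th a)%:E)%E ->
  exists J : Omega -> \bar R, [/\ measurable_fun setT J,
    forall w, (0 <= J w)%E,
    {ae P, forall w,
      (\int[mu w]_(z in jump_window T) (activity_kernel a z.2)%:E = J w)%E} &
    (\int[P]_w J w =
     \int[P]_w \int[lebesgue_measure]_(s in `]0%R, T]) (gbar th a * ll w s)%:E)%E].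
Proof.
move=> gE; have [Q [mQ ndQ Q_cover Qoo]] := mark_exhaustion th.
have us := ap_usual ap.
have prmN : poisson_random_measure P F mark_domain (intensity_default th) N.
  exact: (ap_prm ap).
have Fmeas := filtration_measurable us.
have mH := measurable_predictable_fun Fmeas (measurable_jump_gain T).
have H0 := jump_gain_ge0 T.
pose mc := measurable_cells measurable_mark_domain mQ.
have mJ := @measurable_integral_point_measure _ _ _ _ _ N _ mc _ H0 mH.
exists (fun w => \int[point_measure N mc w]_x jump_gain T (w, x))%E.
split => // [w||].
- exact: integral_ge0.
- have := point_measure_prm prmN measurable_mark_domain mQ ndQ Q_cover Qoo.
  apply: filterS2 (ap_jump_measure ap) => w muw pmw.
  pose S : set (R * (R * R)) := xsection (accepted T) w.
  have mS : measurable S.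
    apply: measurable_xsection.
    exact: (smallest_sub (sigma_algebra_measurable _)
      (predictable_rect_measurable Fmeas)) (measurable_accepted T).
  pose phi (x : R * (R * R)) : R * R := (x.1, x.2.1).
  have mphi : measurable_fun setT phi.
    by apply: measurable_fun_pair => //; exact: measurableT_comp.
  have SE x : S x <-> accepted T (w, x) by rewrite /S /xsection/= inE.
  have SD x : S x -> jump_window T (phi x) by move=> /SE[/= s0 sT y0 _ _].
  have mW := measurable_jump_window T.
  have mphiW : measurable (phi @^-1` jump_window T).
    by rewrite -[_ @^-1` _]setTI; exact: mphi.
  have -> : (\int[point_measure N mc w]_x jump_gain T (w, x) =
      \int[point_measure N mc w]_x (activity_kernel a (phi x).2 * \1_S x)%:E)%E.
    apply: eq_integral => x _; rewrite /jump_gain !indicE.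
    congr (_ * (nat_of_bool _)%:R)%:E.
    by apply/idP/idP; rewrite !inE => /SE.
  apply: (integral_restricted_image mphi mS mW
    (f := fun z => activity_kernel a z.2)) => //.
  + exact: (measurableT_comp measurable_activity_kernel measurable_snd).
  + by move=> z; exact: activity_kernel_ge0.
  move=> A mA AW; rewrite muw//.
  have mA' : measurable (phi @^-1` A).
    by rewrite -[_ @^-1` _]setTI; exact: mphi.
  rewrite (pmw _ (measurableI _ _ mA' mS)).
  have mC := measurableI _ _ measurable_mark_domain mA'.
  transitivity (\int[N w]_(x in mark_domain `&` phi @^-1` A) (\1_S x)%:E)%E.
    apply: eq_integral => x; rewrite inE => -[[/= s0 y0 c0] /= /AW[/= ? ? ?]].
    rewrite !indicE; congr ((nat_of_bool _)%:R%:E).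
    by apply/idP/idP; rewrite !inE/= => h; [apply/SE|case/SE : h].
  rewrite integral_indic//; congr (N w _).
  apply/seteqP; split => x.
    by move=> [Sx [Dx Ax]]; split => //; split => //; case/SE : Sx.
  by move=> [[Ax Sx] [Dx _]].
- rewrite (compensation_formula us prmN measurable_mark_domain mQ ndQ Q_cover Qoo H0
    (measurable_jump_gain T)); last first.
    move=> w x xD; rewrite /jump_gain indicE memNset ?mulr0//.
    by move=> [/= s0 sT y0 c0 _]; apply: xD; split => //; split => //; exact: ltW.
  rewrite fubini_tonelli1//; apply: eq_integral => w _.
  rewrite /fubini_F integral_intensity_default//; last exact: measurable_fun_pair2.
  rewrite [RHS]integral_mkcond; apply: eq_integral => s _.
  rewrite jump_gain_compensator// patchE indicE mem_setE.
  by case: ifPn => _; rewrite ?mul1r ?mul0r.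
Qed.

End activity_jumps.

(** * A path has countably many jumps *)

Section left_limit_ae.
Context {R : realType}.
Implicit Types (x : R -> R) (s t : R).

(** An upward jump at [s] is witnessed by two rationals [q] and [r < s]: the path
stays below [q] on [ ]r, s[] and exceeds [q] at [s]. Two distinct points cannot
share a witness, since the earlier one would lie in the interval of the
later. *)
Lemma countable_jump_up x :
  countable [set s | exists l, [/\ x u @[u --> s^'-] --> l & l < x s]].
Proof.
pose E (qr : rat * rat) : set R :=
  [set s | [/\ ratr qr.2 < s, (forall u, ratr qr.2 < u < s -> x u < ratr qr.1) &
               ratr qr.1 < x s]].
have E1 qr : countable (E qr).
  have [->//|/set0P[s Es]] := eqVneq (E qr) set0.
  apply: (sub_countable _ (countable1 s)); apply: subset_card_le => t Et.
  move: Es Et => [rs sq qs] [rt tq qt]; rewrite /=.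
  have [ts|st|//] := ltgtP t s; exfalso.
  - by have := sq t; rewrite rt ts => /(_ isT); rewrite ltNge (ltW qt).
  - by have := tq s; rewrite rs st => /(_ isT); rewrite ltNge (ltW qs).
apply: (sub_countable (B := \bigcup_qr E qr)); last first.
  by apply: bigcup_countable => // qr _; exact: E1.
apply: subset_card_le => s [l [xl ls]].
have [q] := rat_in_itvoo ls; rewrite in_itv/= => /andP[lq qs].
have : \forall u \near s^'-, x u < ratr q by apply: (cvgr_lt l) => //.
move=> [e /= e0 xe].
have : s - e < s by rewrite ltrBlDr ltrDl.
move=> /rat_in_itvoo[r]; rewrite in_itv/= => /andP[er rs].
exists (q, r) => //; split => //= u /andP[ru us]; apply: xe => //=.
by rewrite ger0_norm ?subr_ge0 ?ltW// ltrBlDr -ltrBlDl (lt_trans er).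
Qed.

Lemma countable_left_jumps x : (forall s, 0 < s -> cvg (x u @[u --> s^'-])) ->
  countable [set s | 0 < s /\ left_limit x s != x s].
Proof.
move=> cx.
apply: (sub_countable (B := [set s | exists l, [/\ x u @[u --> s^'-] --> l & l < x s]]
  `|` [set s | exists l, [/\ - x u @[u --> s^'-] --> l & l < - x s]])).
  apply: subset_card_le => s [s0].
  have -> : left_limit x s = lim (x u @[u --> s^'-]).
    by rewrite /left_limit (gt_eqF s0).
  have xs := cx _ s0; rewrite neq_lt => /orP[ls|sl]; [left|right].
    by exists (lim (x u @[u --> s^'-])).
  by exists (- lim (x u @[u --> s^'-])); rewrite ltrN2; split => //; exact: cvgN.
rewrite -bigcup2E; apply: bigcup_countable => // -[|[|i]] _ /=.
- exact: countable_jump_up.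
- exact: (countable_jump_up (fun u => - x u)).
- exact: countable0.
Qed.

End left_limit_ae.

(** * The total intensity of the activity kernel is finite *)

(** For a measure with a density, the change of measure is read off the region
[A] under the graph of [f]: both sides integrate [h] over [A], sliced in the
two possible orders. *)
Section integral_density.
Context d (T : measurableType d) (R : realType).
Variables (m nu : {sigma_finite_measure set T -> \bar R}) (h f : T -> R).
Hypotheses (mh : measurable_fun setT h) (h0 : forall x, 0 <= h x).
Hypotheses (mf : measurable_fun setT f) (f0 : forall x, 0 <= f x).
Hypothesis nuE : forall A, measurable A -> nu A = (\int[m]_(x in A) (h x)%:E)%E.
Local Notation TR := (measurableTypeR R).

Let A : set (T * TR) := [set z | 0 <= z.2 <= f z.1].

Let mA : measurable A.
Proof.
have m2 : measurable_fun setT (fun z : T * TR => z.2 : R) by exact: measurable_snd.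
have m1 : measurable_fun setT (fun z : T * TR => f z.1).
  exact: measurableT_comp mf measurable_fst.
have a1 := m2 measurableT _ (measurable_itv `[0, +oo[).
have a2 := measurable_fun_ler m2 m1 measurableT (Y := [set true]) I.
rewrite !setTI in a1 a2.
have := measurableI _ _ a1 a2.
set S := (X in measurable X); suff -> : A = S by [].
rewrite /S; apply/seteqP; split => -[x c]; rewrite /A/= in_itv/= andbT.
  by move=> /andP.
by move=> [-> ->].
Qed.

Let m1A : measurable_fun setT (fun z : T * TR => (\1_A z : R)).
Proof. exact: measurable_indic. Qed.

Let section_integral x (r : R) : 0 <= r ->
  (\int[lebesgue_measure]_c (\1_A (x, c) * r)%:E = (f x * r)%:E)%E.
Proof.
move=> r0.
have lI : (lebesgue_measure (`[0%R, f x]%classic : set R) = (f x)%:E)%E.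
  rewrite lebesgue_measure_itv/= lte_fin.
  have := f0 x; rewrite le_eqVlt => /predU1P[<-|->]; first by rewrite ltxx.
  by rewrite oppr0 adde0.
transitivity (\int[lebesgue_measure]_c
    (r%:E * (\1_(`[0%R, f x]%classic) c)%:E))%E.
  apply: eq_integral => c _; rewrite -EFinM mulrC !indicE.
  by congr (_ * (nat_of_bool _)%:R)%:E.
rewrite ge0_integralZl//.
  by rewrite integral_indic// setIT [X in (_ * X)%E]lI EFinM muleC.
by apply/measurable_EFinP; exact: measurable_indic.
Qed.

Lemma integral_density : (\int[nu]_x (f x)%:E = \int[m]_x (f x * h x)%:E)%E.
Proof.
transitivity (\int[nu]_x \int[lebesgue_measure]_c (\1_A (x, c))%:E)%E.
  apply: eq_integral => x _; rewrite -[f x]mulr1 -section_integral//.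
  by apply: eq_integral => c _; rewrite mulr1.
rewrite (@fubini_tonelli _ _ _ _ _ nu (@lebesgue_measure R)
  (fun z => (\1_A z)%:E)) //; last first.
  exact/measurable_EFinP.
have mAh : measurable_fun setT (fun z : T * TR => (\1_A z * h z.1)%:E).
  apply/measurable_EFinP; apply: measurable_funM => //.
  exact: measurableT_comp mh measurable_fst.
transitivity (\int[lebesgue_measure]_c \int[m]_x (\1_A (x, c) * h x)%:E)%E.
  apply: eq_integral => c _; have mAc := measurable_ysection c mA.
  transitivity (\int[nu]_x (\1_(ysection A c) x)%:E)%E.
    apply: eq_integral => x _; rewrite !indicE.
    by congr ((nat_of_bool _)%:R%:E); rewrite mem_ysection.
  transitivity (nu (ysection A c)); first by rewrite integral_indic// setIT.
  rewrite nuE// integral_mkcond.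
  apply: eq_integral => x _; rewrite patchE indicE -mem_ysection.
  by case: ifPn => _; rewrite ?mul1r ?mul0r.
rewrite -(@fubini_tonelli _ _ _ _ _ m (@lebesgue_measure R)
  (fun z => (\1_A z * h z.1)%:E)) //; last first.
  by move=> z; rewrite lee_fin mulr_ge0.
by apply: eq_integral => x _; rewrite -section_integral.
Qed.

End integral_density.

Section gbar_finite.
Context {R : realType}.
Implicit Types (c u : R).

(** The fundamental theorem of calculus bounds the integral on [[1 / (n + 2), 1]]
by [1 / (p + 1)], uniformly in [n]. *)
Lemma integral_powR01_lty (p : R) : -1 < p ->
  (\int[lebesgue_measure]_(u in `]0%R, 1%R]) (u `^ p)%:E < +oo)%E.
Proof.
move=> p1; have p10 : 0 < p + 1 by rewrite -ltrBlDr sub0r.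
pose I n : set R := `[n.+2%:R^-1, 1]%classic.
have UI : `]0, 1]%classic = \bigcup_n I n.
  apply/seteqP; split => [u|u [n _]]; rewrite /I/= !in_itv/=.
    move=> /andP[u0 u1]; exists (Num.truncn u^-1) => //=.
    rewrite in_itv/= u1 andbT invf_ple ?posrE ?ltr0n//.
    by rewrite (le_trans (ltW (truncnS_gt _)))// ler_nat.
  by move=> /andP[nu ->]; rewrite andbT (lt_le_trans _ nu) ?invr_gt0.
have mp : measurable_fun [set: R] (fun u => (u `^ p)%:E).
  by apply/measurable_EFinP; exact: measurable_powR.
have cvgI : (\int[lebesgue_measure]_(u in I n) (u `^ p)%:E @[n --> \oo] -->
    \int[lebesgue_measure]_(u in `]0%R, 1%R]) (u `^ p)%:E)%E.
  rewrite [X in integral _ X]UI; apply: ge0_nondecreasing_set_cvg_integral.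
  - move=> i j ij; apply/subsetPset => u; rewrite /I/= !in_itv/=.
    move=> /andP[iu ->]; rewrite andbT (le_trans _ iu)// lef_pV2 ?posrE//.
    by rewrite ler_nat.
  - by move=> n; exact: measurable_itv.
  - by move=> n; exact: measurable_funTS.
  - by move=> n u _; rewrite lee_fin powR_ge0.
have dF (x : R) : 0 < x ->
    is_derive x 1 (fun u => u `^ (p + 1) / (p + 1)) (x `^ p).
  move=> x0; have := is_derive1_powR (p + 1) x0.
  move=> /(is_deriveZ (p + 1)^-1); rewrite addrK => d.
  have -> : (fun u => u `^ (p + 1) / (p + 1)) = (p + 1)^-1 \*: (@powR R ^~ (p + 1)).
    by apply/funext => u; rewrite /= mulrC.
  by move: d; rewrite /GRing.scale/= mulrA mulVf ?mul1r// gt_eqF.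
apply: (@le_lt_trans _ _ (1 / (p + 1))%:E); last exact: ltry.
rewrite -(cvg_lim _ cvgI)//; apply: lime_le; first by apply/cvg_ex; eexists; exact: cvgI.
apply: nearW => n.
have n0 : 0 < n.+2%:R^-1 :> R by rewrite invr_gt0.
have n1 : n.+2%:R^-1 < 1 :> R by rewrite invf_lt1// ltr1n.
rewrite (@continuous_FTC2 _ _ (fun u => u `^ (p + 1) / (p + 1)))//.
- rewrite lee_fin powR1 lerBlDr lerDl divr_ge0 ?powR_ge0//.
  exact: ltW.
- apply: continuous_in_subspaceT => x; rewrite inE/= in_itv/= => /andP[nx _].
  have x0 := lt_le_trans n0 nx.
  have [dx _] := is_derive1_powR p x0.
  exact/differentiable_continuous/derivable1_diffP.
- have cF (x : R) : 0 < x -> {for x, continuous (fun u => u `^ (p + 1) / (p + 1))}.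
    move=> x0; have [dx _] := dF _ x0.
    exact/differentiable_continuous/derivable1_diffP.
  split.
  + move=> x; rewrite in_itv/= => /andP[nx _].
    by have [] := dF _ (lt_trans n0 nx).
  + exact/cvg_at_right_filter/cF.
  + exact/cvg_at_left_filter/cF.
- move=> x; rewrite in_itv/= => /andP[nx _].
  by rewrite derive1E; have [_ ->] := dF _ (lt_trans n0 nx).
Qed.

Lemma integral_expR_lty c : 0 < c ->
  (\int[lebesgue_measure]_(u in `[0%R, +oo[) (expR (- (c * u)))%:E < +oo)%E.
Proof.
move=> c0.
have := integral_exponential_pdf c0.
have -> : (\int[lebesgue_measure]_x (exponential_pdf c x)%:E =
  c%:E * \int[lebesgue_measure]_(u in `[0%R, +oo[) (expR (- (c * u)))%:E)%E.
  rewrite -ge0_integralZl//; last 2 first.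
  - apply/measurable_EFinP; apply: measurable_funTS.
    by apply: measurableT_comp => //; exact: measurableT_comp.
  - by rewrite lee_fin ltW.
  rewrite [RHS]integral_mkcond; apply: eq_integral => u _.
  rewrite /exponential_pdf !patchE.
  by case: ifPn => //= _; rewrite mulNr EFinM.
move=> h; rewrite ltey; apply/eqP => hoo; move: h; rewrite hoo.
by rewrite gt0_muley ?lte_fin.
Qed.

(** The kernel [1 - exp (- a u^2)] is at most [a u^2] near 0 and at most 1 at
infinity: the two terms of the bound dominate the product on [ ]0, 1]] and
beyond. *)
Lemma tempered_tail_kernel_le (alpha c a u : R) : 0 <= c -> 0 <= a ->
  0 < alpha -> 0 < u ->
  tempered_tail alpha c u * activity_kernel a u <=
  c `^ (2 - alpha) / Gamma_fun (2 - alpha) *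
    (a * (u `^ (1 - alpha) * \1_(`]0, 1]%classic) u) + expR (- (c * u))).
Proof.
move=> c0 a0 al0 u0; rewrite /tempered_tail -mulrA ler_wpM2l//.
  by rewrite divr_ge0 ?powR_ge0// Gamma_fun_ge0.
have e1 : expR (- (c * u)) <= 1.
  by rewrite expR_le1 oppr_le0 mulr_ge0// ltW.
have pu : 0 < u `^ (1 + alpha) by exact: powR_gt0.
have [u1|u1] := leP u 1.
  rewrite indicE mem_set/= ?in_itv/= ?u0// mulr1.
  apply: (@le_trans _ _ (a * u `^ (1 - alpha))); last first.
    by rewrite lerDl expR_ge0.
  have gu : activity_kernel a u <= a * u `^ 2.
    rewrite powR_mulrn; last exact: ltW.
    rewrite /activity_kernel.
    by have := expR_ge1Dx (- (a * u ^+ 2)); lra.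
  have -> : u `^ (1 - alpha) = u `^ 2 / u `^ (1 + alpha).
    rewrite -powRB; last by rewrite (gt_eqF u0) implybT.
    by congr (_ `^ _); lra.
  apply: (@le_trans _ _ ((u `^ (1 + alpha))^-1 * (a * u `^ 2))); last first.
    by rewrite mulrCA [X in a * X <= _]mulrC.
  apply: ler_pM => //.
  - by rewrite divr_ge0 ?expR_ge0// ltW.
  - by rewrite subr_ge0 expR_le1 oppr_le0 mulr_ge0// sqr_ge0.
  - by rewrite ler_pdivrMr// mulVf// gt_eqF.
rewrite indicE memNset/=; last by rewrite in_itv/= u0/= leNgt u1.
rewrite !mulr0 add0r.
apply: (@le_trans _ _ (expR (- (c * u)) * 1)); last by rewrite mulr1.
apply: ler_pM => //.
- by rewrite divr_ge0 ?expR_ge0// ltW.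
- by rewrite subr_ge0 expR_le1 oppr_le0 mulr_ge0// sqr_ge0.
- rewrite ler_pdivrMr// ler_peMr ?expR_ge0//.
  rewrite -[X in X <= _](powRr0 u); apply: ler_powR; first exact: ltW.
  lra.
- by rewrite lerBlDr lerDl expR_ge0.
Qed.

Lemma integral_tempered_kernel_lty (alpha c a : R) : 0 < c -> 0 <= a ->
  0 < alpha -> alpha < 2 ->
  (\int[lebesgue_measure]_(u in `]0%R, +oo[)
    (tempered_tail alpha c u * activity_kernel a u)%:E < +oo)%E.
Proof.
move=> c0 a0 al0 al2.
pose K := c `^ (2 - alpha) / Gamma_fun (2 - alpha).
have K0 : 0 <= K by rewrite divr_ge0 ?powR_ge0// Gamma_fun_ge0.
pose B1 u : \bar R := (u `^ (1 - alpha) * \1_(`]0, 1]%classic) u)%:E.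
pose B2 u : \bar R := (expR (- (c * u)))%:E.
have mB1 : measurable_fun [set: R] B1.
  apply/measurable_EFinP; apply: measurable_funM; first exact: measurable_powR.
  exact: measurable_indic.
have mB2 : measurable_fun [set: R] B2.
  apply/measurable_EFinP.
  by apply: measurableT_comp => //; exact: measurableT_comp.
have B10 u : (0 <= B1 u)%E by rewrite lee_fin mulr_ge0// powR_ge0.
have B20 u : (0 <= B2 u)%E by rewrite lee_fin expR_ge0.
apply: (@le_lt_trans _ _ (\int[lebesgue_measure]_(u in `]0%R, +oo[)
    (K%:E * (a%:E * B1 u + B2 u)))%E).
  apply: ge0_le_integral => //.
  - move=> u _; rewrite lee_fin mulr_ge0 ?tempered_tail_ge0//.
    exact: activity_kernel_ge0.
  - apply/measurable_EFinP; apply: measurable_funTS; apply: measurable_funM.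
      exact: measurable_tempered_tail.
    exact: measurable_activity_kernel.
  - apply: measurable_funTS; apply: measurable_funeM; apply: emeasurable_funD => //.
    exact: measurable_funeM.
  move=> u; rewrite /= in_itv/= andbT => u0.
  suff h : tempered_tail alpha c u * activity_kernel a u <=
      K * (a * (u `^ (1 - alpha) * \1_(`]0, 1]%classic) u) + expR (- (c * u))).
    by rewrite -lee_fin in h.
  by apply: tempered_tail_kernel_le => //; exact: ltW.
have mB1' : measurable_fun (`]0, +oo[%classic : set R) (fun u => a%:E * B1 u)%E.
  by apply: measurable_funTS; exact: measurable_funeM.
have mB2' : measurable_fun (`]0, +oo[%classic : set R) B2 by exact: measurable_funTS.
rewrite ge0_integralZl//; last 2 first.
- exact: emeasurable_funD.
- by move=> u _; rewrite adde_ge0// mule_ge0.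
rewrite lte_mul_pinfty// ?lee_fin//.
rewrite ge0_integralD//; last by move=> u _; rewrite mule_ge0.
rewrite lte_add_pinfty//.
  rewrite ge0_integralZl//; last exact: measurable_funTS.
  rewrite lte_mul_pinfty// ?lee_fin//.
  apply: (@le_lt_trans _ _ (\int[lebesgue_measure]_u B1 u)%E).
    by apply: ge0_subset_integral.
  have := @integral_powR01_lty (1 - alpha).
  rewrite integral_mkcond => h; rewrite (_ : integral _ _ _ =
    (\int[lebesgue_measure]_u ((fun u => (u `^ (1 - alpha))%:E) \_ `]0%R, 1%R]) u)%E).
    by apply: h; lra.
  apply: eq_integral => u _; rewrite /B1 patchE indicE.
  by case: ifPn => _; rewrite ?mulr1 ?mulr0.
apply: (le_lt_trans _ (integral_expR_lty c0)).
apply: ge0_subset_integral => //; first exact: measurable_funTS.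
by move=> u; rewrite /= !in_itv/= !andbT; exact: ltW.
Qed.

(** [gbar] is defined as a real integral, which would be 0 if the extended one
diverged; finiteness is therefore what makes [gbar] the expected jump size per
unit of activity. *)
Lemma levy_activity_kernel_integral (th : tempered_param R) (a : R) : 0 <= a ->
  (\int[levy_measure th]_(y in [set y : R | (y != 0)%R])
     (activity_kernel a y)%:E = (gbar th a)%:E)%E.
Proof.
move=> a0; rewrite /gbar /Rintegral fineK// ge0_fin_numE; last first.
  by apply: integral_ge0 => y _; rewrite lee_fin activity_kernel_ge0.
apply: (@le_lt_trans _ _ (\int[levy_measure th]_y (activity_kernel a y)%:E)%E).
  apply: ge0_subset_integral => //.
  - rewrite (_ : [set _ | _] = ~` [set 0]); first exact: measurableC.
    by apply/seteqP; split => y /eqP.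
  - by apply/measurable_EFinP; exact: measurable_activity_kernel.
  - by move=> y _; rewrite lee_fin activity_kernel_ge0.
rewrite (@integral_density _ _ _ lebesgue_measure (levy_measure th)
  (levy_density th))//; last 4 first.
- exact: measurable_levy_density.
- exact: levy_density_ge0.
- exact: measurable_activity_kernel.
- by move=> y; exact: activity_kernel_ge0.
(* both half-lines reduce to the same function on the positive half-line,
   reflected for the negative jumps *)
pose T c u : \bar R := (tempered_tail (tp_alpha th) c u * activity_kernel a u *
  \1_(`]0, +oo[%classic) u)%:E.
have mT c : measurable_fun [set: R] (T c).
  apply/measurable_EFinP; apply: measurable_funM; last exact: measurable_indic.
  apply: measurable_funM; first exact: measurable_tempered_tail.
  exact: measurable_activity_kernel.
have T0 c u : (0 <= T c u)%E.
  rewrite /T lee_fin mulr_ge0// mulr_ge0 ?tempered_tail_ge0//.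
  exact: activity_kernel_ge0.
have Too c : 0 < c -> (\int[lebesgue_measure]_(u in `[0%R, +oo[) T c u < +oo)%E.
  move=> c0; apply: le_lt_trans (integral_tempered_kernel_lty c0 a0
    (tp_alpha_gt0 th) (tp_alpha_lt2 th)).
  rewrite integral_mkcond [leRHS]integral_mkcond le_eqVlt; apply/orP; left.
  apply/eqP; apply: eq_integral => u _; rewrite !patchE /T indicE.
  have [u0|] := boolP (u \in `]0%R, +oo[%classic).
    rewrite mulr1 ifT//; move: u0; rewrite !inE/= !in_itv/= !andbT.
    exact: ltW.
  by rewrite mulr0; case: ifP.
have mTN c : measurable_fun [set: R] (fun y => T c (- y)).
  by apply: measurableT_comp => //; exact: oppr_measurable.
have mT' (p c : R) : measurable_fun [set: R] (fun y => p%:E * T c y)%E.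
  exact: measurable_funeM.
have mTN' (p c : R) : measurable_fun [set: R] (fun y => p%:E * T c (- y)%R)%E.
  exact: measurable_funeM.
pose p := tp_p th; have p0 : 0 <= p by exact/ltW/tp_p_gt0.
have q0 : 0 <= 1 - p by rewrite subr_ge0; exact/ltW/tp_p_lt1.
have -> : (\int[lebesgue_measure]_y (activity_kernel a y * levy_density th y)%:E =
    \int[lebesgue_measure]_y (p%:E * T (tp_M th) y + (1 - p)%:E * T (tp_G th) (- y)%R))%E.
  apply: eq_integral => y _; rewrite /T -!EFinM -EFinD; congr EFin.
  rewrite /levy_density !indicE !mem_setE !in_itv/= !andbT oppr_gt0.
  have [y0|y0|<-] := ltgtP 0 y.
  - by rewrite /p mulr1n mulr0n; ring.
  - rewrite (ltr0_norm y0) /p.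
    have -> : activity_kernel a y = activity_kernel a (- y).
      by rewrite /activity_kernel sqrrN.
    by rewrite mulr1n mulr0n; ring.
  - by rewrite mulr0n !mulr0 addr0.
have qT0 q c y : 0 <= q -> (0 <= q%:E * T c y)%E.
  by move=> q1; rewrite mule_ge0// lee_fin.
rewrite ge0_integralD; [|exact: measurableT|by move=> y _; exact: qT0
  |exact: mT'|by move=> y _; exact: qT0|exact: mTN'].
have sub (f : R -> \bar R) (D : set R) : measurable D -> measurable_fun setT f ->
    (forall y, 0 <= f y)%E -> (forall y, ~ D y -> f y = 0%E) ->
    (\int[lebesgue_measure]_y f y = \int[lebesgue_measure]_(y in D) f y)%E.
  move=> mD mf f0 fD; rewrite [RHS]integral_mkcond; apply: eq_integral => y _.
  rewrite patchE; case: ifPn => // /negP; rewrite inE => /fD ->.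
  by [].
have TMoo : (\int[lebesgue_measure]_y T (tp_M th) y < +oo)%E.
  rewrite (sub _ `[0, +oo[%classic)//; first exact/Too/tp_M_gt0.
  move=> y y0; rewrite /T indicE memNset ?mulr0// => h; apply: y0.
  by move: h; rewrite /= !in_itv/= !andbT; exact: ltW.
have TGoo : (\int[lebesgue_measure]_y T (tp_G th) (- y)%R < +oo)%E.
  rewrite (sub (fun y => T (tp_G th) (- y)%R) `]-oo, 0]%classic)//.
    rewrite -(ge0_integration_by_substitution0 (mT (tp_G th)) (T0 (tp_G th))).
    exact: Too (tp_G_gt0 th).
  move=> y y0; rewrite /T indicE memNset ?mulr0// => h; apply: y0.
  by move: h; rewrite /= !in_itv/= !andbT oppr_gt0; exact: ltW.
apply: lte_add_pinfty.
- rewrite ge0_integralZl//; last exact: mT.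
  by rewrite lte_mul_pinfty.
- rewrite [ltLHS](_ : _ = (1 - p)%:E *
      \int[lebesgue_measure]_y T (tp_G th) (- y)%R)%E; last first.
    by apply: ge0_integralZl => //; exact: mTN.
  by rewrite lte_mul_pinfty// ?lee_fin.
Qed.

End gbar_finite.

(** * Balance of the mean activity *)

Lemma lebesgue_measure_itv_oc0 (R : realType) (T : R) : 0 <= T ->
  lebesgue_measure (`]0, T]%classic : set R) = T%:E.
Proof.
move=> T0; rewrite lebesgue_measure_itv/= lte_fin; move: T0; rewrite le_eqVlt.
by move=> /predU1P[<-|->]; rewrite ?ltxx// oppr0 adde0.
Qed.

Lemma integrable_cst_oc0 (R : realType) (c T : R) : 0 <= T ->
  (@lebesgue_measure R).-integrable `]0, T] (EFin \o cst c).
Proof.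
move=> T0; apply/integrableP; split; first exact/measurable_EFinP.
rewrite (_ : integral _ _ _ =
    \int[lebesgue_measure]_(s in `]0%R, T]) cst `|c|%:E s)%E//.
have lT := lebesgue_measure_itv_oc0 T0.
by rewrite integral_cst// [X in (_ * X)%E]lT ltry.
Qed.

Section mean_activity.
Context (R : realType) (th : tempered_param R) (kappa lbar eta a : R).
Context d (Omega : measurableType d) (P : probability Omega R).
Variables (F : R -> set (set Omega)) (N : R.-ker Omega ~> (R * (R * R))%type).
Variables (lambda : R -> Omega -> R) (mu : R.-ker Omega ~> (R * R)%type).
Hypotheses (kappa_ge0 : 0 <= kappa) (lbar_ge0 : 0 <= lbar).
Hypotheses (eta_ge0 : 0 <= eta) (a_ge0 : 0 <= a).
Hypothesis ap : activity_process th kappa lbar eta a P F N lambda mu.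

Local Notation ll w s := (left_limit (lambda ^~ w) s).
Local Notation leb := (@lebesgue_measure R).

Lemma measurable_activity t : 0 <= t -> measurable_fun setT (lambda t).
Proof.
move=> t0 _ B mB; rewrite setTI.
by apply: (filtration_measurable (ap_usual ap) t0); exact: (ap_adapted ap).
Qed.

Lemma measurable_activity_joint : measurable_fun setT
  (fun z : Omega * R => if 0 < z.2 then lambda z.2 z.1 else 0).
Proof. exact: measurable_cadlag measurable_activity (ap_cadlag ap). Qed.

Lemma measurable_activity_path w T :
  measurable_fun (`]0, T]%classic : set R) (fun s => lambda s w).
Proof.
apply: (@eq_measurable_fun _ _ R R _ (fun s => if 0 < s then lambda s w else 0)).
  by move=> s; rewrite inE/= in_itv/= => /andP[-> _].
apply: measurable_funTS.
exact: (measurable_fun_pair2 w measurable_activity_joint).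
Qed.

Lemma measurable_left_limit_path w T :
  measurable_fun (`]0, T]%classic : set R) (fun s => ll w s).
Proof.
have Fs := filtration_sigma_algebra (ap_usual ap).
have Fm := filtration_measurable (ap_usual ap).
have := measurable_predictable_left_limit (E := unit) Fs
  (ap_adapted ap) (ap_cadlag ap).
move=> /(measurable_predictable_fun Fm)/(measurable_fun_pair2 w) /= h.
apply: (@eq_measurable_fun _ _ R R _ (fun s => if 0 < s then ll w s else 0)).
  by move=> s; rewrite inE/= in_itv/= => /andP[-> _].
apply: measurable_funTS.
exact: (measurableT_comp h (measurable_pair2 tt)).
Qed.

(** A path and its left limit differ at countably many times. *)
Lemma integral_left_limit_path w T (c : R) : 0 <= c ->
  (\int[leb]_(s in `]0%R, T]) (c * ll w s)%:E =
   \int[leb]_(s in `]0%R, T]) (c * lambda s w)%:E)%E.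
Proof.
move=> c0; apply: ge0_ae_eq_integral => //.
- apply/measurable_EFinP; apply: measurable_funM => //.
  exact: measurable_left_limit_path.
- apply/measurable_EFinP; apply: measurable_funM => //.
  exact: measurable_activity_path.
- move=> s; rewrite /= in_itv/= => /andP[s0 _].
  by rewrite lee_fin mulr_ge0// (left_limit_ge0 ap).
- move=> s; rewrite /= in_itv/= => /andP[s0 _].
  by rewrite lee_fin mulr_ge0// (ap_ge0 ap)// ltW.
have [_ cll] := ap_cadlag ap w.
have cJ := countable_left_jumps cll.
exists [set s | 0 < s /\ left_limit (lambda ^~ w) s != lambda s w]; split.
- exact: countable_measurable.
- exact: countable_lebesgue_measure0.
move=> s /= /not_implyP[]; rewrite in_itv/= => /andP[s0 _] h; split => //.
by apply/eqP => e; apply: h; rewrite e.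
Qed.

(** Valued in the extended reals, like [emean] below: that the mean and the
expected occupation are finite is a separate issue, and the balance of the
mean has to be available before it is settled. *)
Definition occupation T w : \bar R :=
  (\int[leb]_(s in `]0%R, T]) (lambda s w)%:E)%E.

Let L T (z : Omega * R) : \bar R :=
  ((if 0 < z.2 then lambda z.2 z.1 else 0) * \1_(`]0, T]%classic) z.2)%:E.

Let mL T : measurable_fun [set: Omega * measurableTypeR R] (L T).
Proof.
apply/measurable_EFinP; apply: measurable_funM.
  exact: measurable_activity_joint.
by apply: (measurableT_comp _ measurable_snd); exact: measurable_indic.
Qed.

Let L0 T z : (0 <= L T z)%E.
Proof.
rewrite lee_fin mulr_ge0//; case: ifPn => // z0.
by rewrite (ap_ge0 ap)// ltW.
Qed.

Let LE T w : occupation T w = (\int[leb]_s L T (w, s))%E.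
Proof.
rewrite /occupation integral_mkcond; apply: eq_integral => s _.
rewrite patchE /L/= indicE; case: ifPn => [|_]; last by rewrite mulr0.
by rewrite inE/= in_itv/= => /andP[-> _]; rewrite mulr1.
Qed.

Lemma occupation_ge0 T w : (0 <= occupation T w)%E.
Proof. by rewrite LE; exact: integral_ge0. Qed.

Lemma measurable_occupation T : measurable_fun setT (occupation T).
Proof.
rewrite (_ : occupation T = fubini_F leb (L T)).
  exact: measurable_fun_fubini_tonelli_F.
by apply/funext => w; rewrite LE.
Qed.

Definition emean t : \bar R := (\int[P]_w (lambda t w)%:E)%E.

Lemma emean_ge0 t : 0 <= t -> (0 <= emean t)%E.
Proof. by move=> t0; apply: integral_ge0 => w _; rewrite lee_fin (ap_ge0 ap). Qed.

(** The two marginal integrals of [L T] are the occupation and the mean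
activity, which [expected_occupation] exchanges by Tonelli's theorem. *)
Let GE T s : (fubini_G P (L T) s = (emean \_ `]0%R, T]) s)%E.
Proof.
rewrite patchE /fubini_G /L/= indicE; case: ifPn => sT.
  apply: eq_integral => w _; move: sT; rewrite inE/= in_itv/= => /andP[-> _].
  by rewrite mulr1.
by apply: integral0_eq => w _; rewrite mulr0.
Qed.

Lemma measurable_emean T :
  measurable_fun (`]0, T]%classic : set R) emean.
Proof.
apply/(measurable_restrictT _ _).2 => //.
rewrite (_ : _ \_ _ = fubini_G P (L T)); last by apply/funext => s; rewrite GE.
have h : measurable_fun [set: measurableTypeR R] (fubini_G P (L T)).
  exact: measurable_fun_fubini_tonelli_G.
exact: h.
Qed.

Lemma expected_occupation T :
  (\int[P]_w occupation T w = \int[leb]_(s in `]0%R, T]) emean s)%E.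
Proof.
transitivity (\int[P]_w \int[leb]_s L T (w, s))%E.
  by apply: eq_integral => w _; rewrite LE.
rewrite fubini_tonelli// [RHS]integral_mkcond; apply: eq_integral => s _.
by rewrite -GE.
Qed.

Lemma integral_drift w (T : R) : 0 <= T -> (occupation T w < +oo)%E ->
  (\int[leb]_(s in `[0%R, T]) (kappa * (lbar - lambda s w))%:E =
   (kappa * lbar * T - kappa * fine (occupation T w))%:E)%E.
Proof.
move=> T0 Ooo; have mp := @measurable_activity_path w T.
rewrite -integral_itv_obnd_cbnd; last first.
  apply/measurable_EFinP; apply: measurable_funM => //.
  exact: measurable_funB.
have lT := lebesgue_measure_itv_oc0 T0.
have i1 := integrable_cst_oc0 (kappa * lbar) T0.
have i2 : leb.-integrable `]0%R, T] (EFin \o (fun s => lambda s w)).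
  apply/integrableP; split; first exact/measurable_EFinP.
  rewrite (_ : integral _ _ _ = occupation T w)//.
  apply: eq_integral => s; rewrite inE/= in_itv/= => /andP[s0 _].
  by rewrite ger0_norm// (ap_ge0 ap)// ltW.
have i3 : leb.-integrable `]0%R, T] (EFin \o (fun s => kappa * lambda s w)).
  rewrite (_ : _ \o _ = (fun s => kappa%:E * (lambda s w)%:E)%E)//.
  by apply: integrableZl => //; exact: i2.
transitivity (\int[leb]_(s in `]0%R, T])
    ((cst (kappa * lbar) s)%:E - (kappa * lambda s w)%:E))%E.
  by apply: eq_integral => s _; rewrite -EFinB mulrBr.
have c1 : (\int[leb]_(s in `]0%R, T]) (cst (kappa * lbar) s)%:E =
    (kappa * lbar * T)%:E)%E.
  rewrite (_ : integral _ _ _ =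
      \int[leb]_(s in `]0%R, T]) cst (kappa * lbar)%:E s)%E//.
  by rewrite integral_cst// [X in (_ * X)%E]lT.
have c2 : (\int[leb]_(s in `]0%R, T]) (kappa * lambda s w)%:E =
    (kappa * fine (occupation T w))%:E)%E.
  rewrite EFinM fineK; last by rewrite ge0_fin_numE// occupation_ge0.
  by rewrite /occupation -integralZl.
by rewrite integralB_EFin// c1 c2.
Qed.

(** Expectation of the stochastic equation. The negative part of the drift is
moved to the left-hand side, so that all the terms are nonnegative and
integrate additively in the extended reals; the jump term is given by
[expected_jumps]. *)
Lemma mean_balance (T : R) : 0 <= T ->
  (\int[P]_w occupation T w < +oo)%E -> (emean 0 < +oo)%E ->
  (emean T + kappa%:E * \int[leb]_(s in `]0%R, T]) emean s =
   emean 0 + (kappa * lbar * T)%:E +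
   (eta * gbar th a)%:E * \int[leb]_(s in `]0%R, T]) emean s)%E.
Proof.
move=> T0 Ooo m0oo.
have gE := levy_activity_kernel_integral th a_ge0.
have gb0 : 0 <= gbar th a.
  rewrite -lee_fin -gE; apply: integral_ge0 => y _.
  by rewrite lee_fin; exact: activity_kernel_ge0.
have [J [mJ J0 muJ EJ]] := expected_jumps a_ge0 ap T gE.
have {}EJ : (\int[P]_w J w =
    (gbar th a)%:E * \int[leb]_(s in `]0%R, T]) emean s)%E.
  rewrite EJ -expected_occupation -ge0_integralZl//; last 2 first.
  - exact: measurable_occupation.
  - by move=> w _; exact: occupation_ge0.
  apply: eq_integral => w _; rewrite integral_left_limit_path//.
  rewrite /occupation -ge0_integralZl//.
  - by apply/measurable_EFinP; exact: measurable_activity_path.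
  - move=> s; rewrite /= in_itv/= => /andP[s0 _].
    by rewrite lee_fin (ap_ge0 ap)// ltW.
have Oae : {ae P, forall w, (occupation T w < +oo)%E}.
  have iO : P.-integrable setT (occupation T).
    apply/integrableP; split; first exact: measurable_occupation.
    rewrite (_ : integral _ _ _ = \int[P]_w occupation T w)%E//.
    by apply: eq_integral => w _; rewrite gee0_abs// occupation_ge0.
  apply: filterS (integrable_ae measurableT iO) => w /(_ I).
  by rewrite ge0_fin_numE// occupation_ge0.
have path : {ae P, forall w, ((lambda T w)%:E + kappa%:E * occupation T w =
    (lambda 0 w)%:E + (kappa * lbar * T)%:E + eta%:E * J w)%E}.
  apply: filterS3 Oae muJ (ap_sde ap) => w wO wJ /(_ T T0).
  rewrite integral_drift// wJ.
  have oE : occupation T w = (fine (occupation T w))%:E.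
    by rewrite fineK// ge0_fin_numE// occupation_ge0.
  move: (fine (occupation T w)) oE => o -> e.
  have : (0 <= eta%:E * J w)%E by rewrite mule_ge0.
  case: (eta%:E * J w)%E e => [j| |] // e _.
  have e' : lambda T w =
      lambda 0 w + (kappa * lbar * T - kappa * o) + j by case: e.
  have h : lambda T w + kappa * o = lambda 0 w + kappa * lbar * T + j by lra.
  exact: (congr1 EFin h).
have mlam t : 0 <= t -> measurable_fun setT (fun w => (lambda t w)%:E).
  by move=> t0; apply/measurable_EFinP; exact: measurable_activity.
have lam0 t w : 0 <= t -> (0 <= (lambda t w)%:E)%E.
  by move=> t0; rewrite lee_fin (ap_ge0 ap).
have mO : measurable_fun setT (fun w => kappa%:E * occupation T w)%E.
  by apply: measurable_funeM; exact: measurable_occupation.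
have mJ' : measurable_fun setT (fun w => eta%:E * J w)%E by exact: measurable_funeM.
have kO0 w : (0 <= kappa%:E * occupation T w)%E.
  by rewrite mule_ge0// occupation_ge0.
have eJ0 w : (0 <= eta%:E * J w)%E by rewrite mule_ge0.
have mlc : measurable_fun setT (fun w => (lambda 0 w)%:E + (kappa * lbar * T)%:E)%E.
  by apply: emeasurable_funD => //; exact: mlam.
have klT : (0 <= (kappa * lbar * T)%:E)%E by rewrite lee_fin !mulr_ge0.
transitivity (\int[P]_w ((lambda T w)%:E + kappa%:E * occupation T w))%E.
  rewrite [RHS](ge0_integralD P measurableT (fun w _ => lam0 T w T0)
    (mlam T T0) (fun w _ => kO0 w) mO).
  rewrite ge0_integralZl//; last 2 first.
  - exact: measurable_occupation.
  - by move=> w _; exact: occupation_ge0.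
  by rewrite expected_occupation.
transitivity (\int[P]_w ((lambda 0 w)%:E + (kappa * lbar * T)%:E + eta%:E * J w))%E.
  apply: ge0_ae_eq_integral => //.
  - by apply: emeasurable_funD => //; exact: mlam.
  - exact: emeasurable_funD.
  - by move=> w _; rewrite adde_ge0// lam0.
  - by move=> w _; rewrite !adde_ge0// lam0.
  by apply: filterS path => w + _.
rewrite (ge0_integralD P measurableT
  (fun w _ => adde_ge0 (lam0 0 w (lexx 0)) klT) mlc
  (fun w _ => eJ0 w) mJ').
rewrite (ge0_integralD P measurableT (fun w _ => lam0 0 w (lexx 0))
  (mlam 0 (lexx 0)) (fun w _ => klT) (measurable_cst _)).
rewrite ge0_integralZl// EJ muleA -EFinM; congr (_ + _ + _)%E.
rewrite integral_cst// [X in (_ * X)%E](_ : _ = 1%E) ?mule1//.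
exact: probability_setT.
Qed.

Hypothesis occupation_fin : forall T : R, 0 <= T ->
  (\int[P]_w occupation T w < +oo)%E.
Hypothesis emean0_fin : (emean 0 < +oo)%E.

Local Notation m := (first_moment P lambda).

Lemma first_momentE t : m t = fine (emean t).
Proof. by rewrite /first_moment unlock. Qed.

(** The right-hand side of the balance is finite and bounds the mean. *)
Lemma emean_fin t : 0 <= t -> (emean t < +oo)%E.
Proof.
move=> t0; have O0 : (0 <= \int[leb]_(s in `]0%R, t]) emean s)%E.
  apply: integral_ge0 => s; rewrite /= in_itv/= => /andP[s0 _].
  exact/emean_ge0/ltW.
apply: (@le_lt_trans _ _
    (emean t + kappa%:E * \int[leb]_(s in `]0%R, t]) emean s)%E).
  by rewrite leeDl// mule_ge0.
rewrite mean_balance//; last exact: occupation_fin.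
apply: lte_add_pinfty; first by apply: lte_add_pinfty => //; exact: ltry.
rewrite -expected_occupation lte_mul_pinfty// ?occupation_fin// lee_fin mulr_ge0//.
rewrite -lee_fin -(levy_activity_kernel_integral th a_ge0).
by apply: integral_ge0 => y _; rewrite lee_fin; exact: activity_kernel_ge0.
Qed.

Lemma emeanE t : 0 <= t -> emean t = (m t)%:E.
Proof.
move=> t0; rewrite first_momentE fineK// ge0_fin_numE ?emean_fin//.
exact: emean_ge0.
Qed.

Lemma first_moment_integrable (T : R) : 0 <= T ->
  leb.-integrable `]0, T] (EFin \o m).
Proof.
move=> T0; apply/integrableP; split.
  apply: (@eq_measurable_fun _ _ _ _ _ emean); last exact: measurable_emean.
  by move=> s; rewrite inE/= in_itv/= => /andP[s0 _]; rewrite emeanE// ltW.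
have := occupation_fin T0; rewrite expected_occupation; apply: le_lt_trans.
rewrite le_eqVlt; apply/orP; left; apply/eqP.
apply: eq_integral => s; rewrite inE/= in_itv/= => /andP[/ltW s0 _].
by rewrite ger0_norm -?emeanE// -lee_fin -emeanE// emean_ge0.
Qed.

Lemma first_moment_integral_equation (T : R) : 0 <= T ->
  m T = m 0 + (\int[leb]_(s in `]0, T])
    (kappa * lbar - (kappa - eta * gbar th a) * m s))%R.
Proof.
move=> T0; have mi := first_moment_integrable T0.
have lT := lebesgue_measure_itv_oc0 T0.
have ci := integrable_cst_oc0 (kappa * lbar) T0.
have zi : leb.-integrable `]0, T]
    (EFin \o (fun s => (kappa - eta * gbar th a) * m s)).
  rewrite (_ : _ \o _ =
    (fun s => (kappa - eta * gbar th a)%:E * (m s)%:E)%E)//.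
  by apply: integrableZl => //; exact: mi.
rewrite (RintegralB (f1 := cst (kappa * lbar)))// RintegralZl//.
rewrite Rintegral_cst// [X in _ * X](_ : _ = T); last first.
  by rewrite [X in fine X]lT.
have := mean_balance T0 (occupation_fin T0) emean0_fin.
have -> : (\int[leb]_(s in `]0%R, T]) emean s =
    (\int[leb]_(s in `]0, T]) m s)%R%:E)%E.
  rewrite /Rintegral fineK; last exact: integrable_fin_num.
  apply: eq_integral => s; rewrite inE/= in_itv/= => /andP[s0 _].
  by rewrite emeanE// ltW.
rewrite !emeanE// => -[]; lra.
Qed.

End mean_activity.

(** * The affine integral equation *)

Section affine_integral_equation.
Context {R : realType}.
Local Notation leb := (@lebesgue_measure R).
Variables (m : R -> R) (b c : R).
Hypothesis m_int : forall T : R, 0 <= T -> leb.-integrable `]0, T] (EFin \o m).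
Hypothesis mE : forall T : R, 0 <= T ->
  m T = m 0 + (\int[leb]_(s in `]0, T]) (b - c * m s))%R.

(** An integrable solution is continuous, being an indefinite integral, hence the
integrand is continuous and the solution is differentiable. *)
Let f s := b - c * m s.

Let f_int (T : R) : 0 <= T -> leb.-integrable `]0, T] (EFin \o f).
Proof.
move=> T0.
rewrite (_ : _ \o _ = (cst b%:E \- (fun s => c%:E * (m s)%:E))%E)//.
apply: integrableB => //; first exact: integrable_cst_oc0.
by apply: integrableZl => //; exact: m_int.
Qed.

Let f_int0 (T : R) : 0 <= T -> leb.-integrable `[0, T] (EFin \o f).
Proof.
move=> /f_int /integrableP[mf foo]; apply/integrableP.
have mf' : measurable_fun (`[0, T]%classic : set R) (EFin \o f).
  by apply/emeasurable_fun_itv_obnd_cbndP; exact: mf.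
split; first exact: mf'.
rewrite -integral_itv_obnd_cbnd//.
by apply: measurableT_comp => //; exact: mf.
Qed.

Let mE0 (T : R) : 0 <= T -> m T = m 0 + (\int[leb]_(s in `[0, T]) f s)%R.
Proof.
move=> T0; rewrite mE//; congr (_ + _).
have /integrableP[/measurable_EFinP mf _] := f_int T0.
by rewrite Rintegral_itv_obnd_cbnd//; exact: f_int.
Qed.

Lemma affine_solution_within_continuous (T : R) : 0 <= T ->
  {within `[0, T], continuous m}.
Proof.
move=> T0.
have cI := parameterized_integral_continuous T0 (f_int0 T0).
apply: (@subspace_eq_continuous _ _ _
  (fun x => m 0 + parameterized_integral leb 0 x f)).
  by move=> x; rewrite inE/= in_itv/= => /andP[x0 _]; exact/esym/mE0.
by move=> x; apply: cvgD; [exact: cvg_cst|exact: cI].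
Qed.

Lemma affine_solution_continuous (t : R) : 0 < t -> {for t, continuous m}.
Proof.
move=> t0; have t1 : 0 < t + 1 by rewrite addr_gt0.
apply: (within_continuous_continuous t1).
  exact/affine_solution_within_continuous/ltW.
by rewrite in_itv/= t0/= ltrDl.
Qed.

Lemma affine_solution_is_derive (t : R) : 0 < t ->
  is_derive t 1 m (b - c * m t).
Proof.
move=> t0; have t1 : t < t + 1 by rewrite ltrDl.
have cf : {for t, continuous f}.
  apply: cvgB; first exact: cvg_cst.
  by apply: cvgM; [exact: cvg_cst|exact: affine_solution_continuous].
have [dI IE] := continuous_FTC1_closed t1
  (f_int0 (ltW (lt_trans t0 t1))) t0 cf.
set I := (fun x => _) in dI IE.
apply: (@near_eq_is_derive _ _ _ (fun x => m 0 + I x)).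
  near=> x; apply/esym/mE0; near: x.
  by apply: filterS (lt_nbhsr t0) => x /ltW.
have -> : b - c * m t = 0 + f t by rewrite add0r.
have dIt : is_derive t 1 I (f t).
  by apply: DeriveDef; [exact: dI|rewrite -derive1E; exact: IE].
exact: (@is_deriveD _ _ _ (cst (m 0)) I t 1 0 (f t) (is_derive_cst _ _ _) dIt).
Unshelve. all: by end_near. Qed.

(** By the mean value theorem the difference quotient at 0 is a value of the
right-hand side at an intermediate time, which tends to 0. *)
Lemma affine_solution_right_derive :
  (m h - m 0) / h @[h --> 0^'+] --> b - c * m 0.
Proof.
have m0 : m x @[x --> 0^'+] --> m 0.
  have := affine_solution_within_continuous ler01.
  by move=> /(continuous_within_itvP _ ltr01)[].
have f0 : f x @[x --> 0^'+] --> f 0.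
  by apply: cvgB; [exact: cvg_cst|apply: cvgM => //; exact: cvg_cst].
apply/cvgrPdist_lt => e e0.
have /cvgrPdist_lt/(_ e e0)[r /= r0 fr] := f0.
near=> h; have h0 : 0 < h by near: h; exact: nbhs_right_gt.
have hr : h < r by near: h; exact: nbhs_right_lt.
have dm (x : R) : x \in `]0, h[ -> is_derive x 1 m (f x).
  by rewrite in_itv/= => /andP[x0 _]; exact: affine_solution_is_derive.
have [x /[!in_itv]/= /andP[x0 xh] ->] := @MVT _ m f 0 h h0 dm
  (affine_solution_within_continuous (ltW h0)).
rewrite subr0 mulfK ?gt_eqF//; apply: fr => //=.
by rewrite sub0r normrN gtr0_norm// (lt_trans xh).
Unshelve. all: by end_near. Qed.

(** The function [(m t - b / c) * exp (c t)] has derivative 0, so [m] is [b / c]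
plus a decaying exponential. *)
Lemma affine_solution_limit : 0 < c -> m t @[t --> +oo] --> b / c.
Proof.
move=> c0.
have c_neq0 : c != 0 by rewrite gt_eqF.
pose u t := (m t - b / c) * expR (c * t).
have du (t : R) : 0 < t -> is_derive t 1 u 0.
  move=> t0; have dm := affine_solution_is_derive t0.
  have -> : 0 = (m t - b / c) * (c * expR (c * t)) +
      expR (c * t) * (b - c * m t) :> R.
    by field.
  have dE : is_derive t 1 (fun t => expR (c * t)) (c * expR (c * t)).
    have dl : is_derive t 1 (fun t => c * t) c.
      rewrite -[X in is_derive _ _ _ X]mulr1.
      exact: (@is_deriveZ _ _ _ id c t 1 1 (is_derive_id _ _)).
    have [dl1 dl2] := dl; apply: DeriveDef.
      apply/derivable1_diffP.
      apply: (@differentiable_comp _ _ _ _ (fun t => c * t) expR).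
        exact/derivable1_diffP.
      exact/derivable1_diffP/derivable_expR.
    have de : derivable (@expR R) (c * t) 1 by exact: derivable_expR.
    rewrite -derive1E (derive1_comp dl1 de).
    by rewrite !derive1E dl2 derive_val mulrC.
  have dB : is_derive t 1 (fun t => m t - b / c) (b - c * m t).
    rewrite -[X in is_derive _ _ _ X]subr0.
    exact: (@is_deriveB _ _ _ m (cst (b / c)) t 1 _ 0 dm (is_derive_cst _ _ _)).
  exact: (@is_deriveM _ _ _ _ t 1 _ _ dB dE).
have uE (t : R) : 1 <= t -> u t = u 1.
  move=> t1; apply/eqP; rewrite -subr_eq0; apply/eqP.
  have cu : {within `[1, t], continuous u}.
    apply: derivable_within_continuous => x; rewrite in_itv/= => /andP[x1 _].
    by have [] := du x (lt_le_trans ltr01 x1).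
  have du' (x : R) : x \in `]1, t[ -> is_derive x 1 u (cst 0 x).
    by rewrite in_itv/= => /andP[x1 _]; exact: du x (lt_trans ltr01 x1).
  have [x _ ->] := @MVT_segment _ u (cst 0) 1 t t1 du' cu.
  by rewrite mul0r.
have : b / c + u 1 * expR (- (c * t)) @[t --> +oo] --> b / c + u 1 * 0.
  apply: cvgD; first exact: cvg_cst.
  apply: cvgM; first exact: cvg_cst.
  apply: (cvg_comp _ _ _ (@cvgr_expR R)).
  by apply: gt0_cvgMry => //; exact: cvg_id.
rewrite mulr0 addr0; apply: cvg_trans; apply: near_eq_cvg.
near=> t; have t1 : 1 <= t by near: t; apply: nbhs_pinfty_ge; rewrite num_real.
rewrite -(uE t t1).
by rewrite /u -mulrA -expRD subrr expR0 mulr1 addrC subrK.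
Unshelve. all: by end_near. Qed.

End affine_integral_equation.

(** * Transfer to a variable with the same law *)

Section observables.
Context (R : realType) (th : tempered_param R) (kappa lbar eta a : R).
Context d (Omega : measurableType d) (P : probability Omega R).
Variables (F : R -> set (set Omega)) (N : R.-ker Omega ~> (R * (R * R))%type).
Variables (lambda : R -> Omega -> R) (mu : R.-ker Omega ~> (R * R)%type).
Hypothesis ap : activity_process th kappa lbar eta a P F N lambda mu.
Context d0 (Omega0 : measurableType d0) (P0 : probability Omega0 R).
Variable X : {RV P0 >-> R}.
Variable t : R.
Hypothesis t0 : 0 <= t.
Hypothesis lawE : forall A, measurable A -> P (lambda t @^-1` A) = distribution P0 X A.

Lemma law_integralE (f : R -> \bar R) : measurable_fun setT f ->
  (forall x, 0 <= f x)%E ->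
  (\int[P]_w f (lambda t w) = \int[P0]_w f (X w))%E.
Proof.
move=> mf f0.
have ml := measurable_activity ap t0.
have := ge0_integral_pushforward ml P measurableT mf (fun x _ => f0 x).
rewrite preimage_setT => <-.
have := ge0_integral_pushforward (@measurable_funPT _ _ _ _ X) P0 measurableT mf (fun x _ => f0 x).
rewrite preimage_setT => <-.
by apply: eq_measure_integral => A mA _; exact: lawE.
Qed.

Lemma law_nonneg_ae : {ae P0, forall w, 0 <= X w}.
Proof.
have mN : measurable (`]-oo, 0[%classic : set R) by [].
exists (X @^-1` `]-oo, 0[%classic); split.
- by rewrite -[X in measurable X]setTI; exact: measurable_funPT.
- have := lawE mN; rewrite (_ : lambda t @^-1` _ = set0) ?measure0//.
  apply/seteqP; split => // w /=; rewrite in_itv/= => h.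
  by have := ap_ge0 ap w t0; rewrite leNgt h.
- by move=> w /= /negP; rewrite -ltNge in_itv.
Qed.

(** The law of [X] is that of a nonnegative variable, so the expectation of [X] is
that of its absolute value, a nonnegative observable. *)
Lemma law_expectation : P0.-integrable setT (EFin \o X) ->
  'E_P0[X]%E = emean P lambda t.
Proof.
move=> iX; rewrite unlock /emean.
transitivity (\int[P0]_w `|(X w)%:E|)%E.
  apply: ae_eq_integral => //.
  - exact: (measurable_int _ iX).
  - by apply: measurableT_comp => //; exact: (measurable_int _ iX).
  - by apply: filterS law_nonneg_ae => w w0 _; rewrite gee0_abs.
rewrite -(law_integralE (f := fun x => `|x%:E|%E))//.
- by apply: eq_integral => w _; rewrite gee0_abs// lee_fin (ap_ge0 ap).
- by apply: measurableT_comp => //; exact/measurable_EFinP.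
Qed.

End observables.

(** * The mean of the activity process *)

Theorem proposition3p2 (R : realType) (th : tempered_param R)
    (kappa lbar eta a : R)
    (kappa_gt0 : 0 < kappa) (lbar_gt0 : 0 < lbar)
    (eta_ge0 : 0 <= eta) (a_gt0 : 0 < a) :
  (forall (d : measure_display) (Omega : measurableType d)
      (P : probability Omega R) (F : R -> set (set Omega))
      (N : R.-ker Omega ~> (R * (R * R))%type)
      (lambda : R -> Omega -> R) (mu : R.-ker Omega ~> (R * R)%type)
      (lambda0 : R),
    activity_process th kappa lbar eta a P F N lambda mu ->
    (forall T : R, 0 <= T ->
      (\int[P]_w \int[lebesgue_measure]_(s in `[0%R, T]) (lambda s w)%:E
         < +oo)%E) ->
    0 < lambda0 ->
    {ae P, forall w, lambda 0 w = lambda0} ->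
    let m := first_moment P lambda in
    [/\ forall t : R, 0 <= t -> P.-integrable setT (EFin \o lambda t),
        forall t : R, 0 < t ->
          is_derive t 1 m (kappa * lbar - (kappa - eta * gbar th a) * m t),
        (m h - m 0) / h @[h --> 0^'+] -->
          kappa * lbar - (kappa - eta * gbar th a) * m 0,
        m 0 = lambda0 &
        eta * gbar th a < kappa ->
          m t @[t --> +oo] --> kappa * lbar / (kappa - eta * gbar th a)])
  /\
  (eta * gbar th a < kappa ->
    forall (d : measure_display) (Omega : measurableType d)
      (P : probability Omega R) (lambda_infty : {RV P >-> R}),
    stationary_distribution th kappa lbar eta a
      (distribution P lambda_infty) ->
    P.-integrable setT (EFin \o lambda_infty) ->
    'E_P[lambda_infty]%E = (kappa * lbar / (kappa - eta * gbar th a))%:E).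
Proof.
have [kappa0 lbar0 a0] := And3 (ltW kappa_gt0) (ltW lbar_gt0) (ltW a_gt0).
split.
  move=> d Omega P F N lambda mu lambda0 ap occ lambda0_gt0 init m.
  have occupation_fin (T : R) : 0 <= T ->
      (\int[P]_w occupation lambda T w < +oo)%E.
    move=> T0; apply: le_lt_trans (occ T T0).
    rewrite le_eqVlt; apply/orP; left; apply/eqP.
    apply: eq_integral => w _; rewrite /occupation integral_itv_obnd_cbnd//.
    by apply/measurable_EFinP; exact: (measurable_activity_path ap).
  have emean0 : emean P lambda 0 = lambda0%:E.
    transitivity (\int[P]_w cst lambda0%:E w)%E.
      apply: ge0_ae_eq_integral => //.
      - by apply/measurable_EFinP; exact: (measurable_activity ap).
      - by move=> w _; rewrite lee_fin (ap_ge0 ap).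
      - by move=> w _; rewrite lee_fin ltW.
      - by apply: filterS init => w /= -> _.
    rewrite integral_cst// [X in (_ * X)%E](_ : _ = 1%E) ?mule1//.
    exact: probability_setT.
  have emean0_fin : (emean P lambda 0 < +oo)%E by rewrite emean0 ltry.
  have m_int T (T0 : 0 <= T) :=
    first_moment_integrable kappa0 lbar0 eta_ge0 a0 ap occupation_fin
      emean0_fin T0.
  have mE T (T0 : 0 <= T) :=
    first_moment_integral_equation kappa0 lbar0 eta_ge0 a0 ap occupation_fin
      emean0_fin T0.
  split.
  - move=> t t0; apply/integrableP; split.
      by apply/measurable_EFinP; exact: (measurable_activity ap).
    apply: le_lt_trans (emean_fin kappa0 lbar0 eta_ge0 a0 ap
      occupation_fin emean0_fin t0).
    rewrite le_eqVlt; apply/orP; left; apply/eqP.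
    by apply: eq_integral => w _; rewrite gee0_abs// lee_fin (ap_ge0 ap).
  - by move=> t t0; exact: (affine_solution_is_derive m_int mE).
  - exact: (affine_solution_right_derive m_int mE).
  - by rewrite /m first_momentE emean0.
  - by move=> sub; apply: (affine_solution_limit m_int mE); rewrite subr_gt0.
move=> sub d0 Omega0 P0 X.
move=> [] d [] Omega [] P [] F [] N [] lambda [] mu [] ap lawE iX.
have EX t (t0 : 0 <= t) := law_expectation ap t0 (lawE t t0) iX.
have EXfin : 'E_P0[X]%E \is a fin_num.
  by rewrite unlock; exact: integrable_fin_num.
case: ('E_P0[X]%E) EX EXfin => // M EX _.
(* the mean is constant in time, hence so is its average over [ ]0, 1]] *)
have mean_int : (\int[lebesgue_measure]_(s in `]0%R, 1%R]) emean P lambda s = M%:E)%E.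
  transitivity (\int[lebesgue_measure]_(s in `]0%R, 1%R]) cst M%:E s)%E.
    by apply: eq_integral => s; rewrite inE/= in_itv/= => /andP[/ltW/EX].
  rewrite integral_cst// [X in (_ * X)%E](_ : _ = 1%E) ?mule1//.
  exact: lebesgue_measure_itv_oc0.
have := @mean_balance _ _ _ _ _ _ _ _ _ _ _ _ _ kappa0 lbar0 eta_ge0 a0 ap 1 ler01.
rewrite (expected_occupation ap) mean_int -!EX// !ltry => /(_ isT isT).
rewrite mulr1 -!EFinM -!EFinD => -[bal].
congr EFin; have c_neq0 : kappa - eta * gbar th a != 0.
  by rewrite subr_eq0 gt_eqF.
by apply: (mulIf c_neq0); rewrite divfK//; lra.
Qed.
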